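(* Let $k \ge 6$ be an integer, and assume the truth of the $abc$-conjecture. For $H\ge 1$ let $M_{k,\mathrm{loc}}(H)$ be the number of triples $(a,b,c)\in\mathbb{Z}^3$ with $0<|a|,|b|,|c|\le H$ such that the equation $ax^k+by^k+cz^k=0$ has a non-trivial (i.e. not all of $x,y,z$ zero) solution over $\mathbb{R}$ and a non-trivial solution over $\mathbb{Z}_p$ for every prime $p$, and let $M_{k,\mathrm{glob}}(H)$ be the number of triples $(a,b,c)\in\mathbb{Z}^3$ with $0<|a|,|b|,|c|\le H$ such that $ax^k+by^k+cz^k=0$ has a solution $(x,y,z)\in\mathbb{Z}^3\setminus\{(0,0,0)\}$. Then \[ \frac{M_{k,\mathrm{glob}}(H)}{M_{k,\mathrm{loc}}(H)} \to 0 \quad (H\to\infty). \]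
   Context: The $abc$-conjecture asserts: for every $\varepsilon>0$ there is a constant $C_\varepsilon$ such that whenever $a,b,c\in\mathbb{Z}$ satisfy $a+b=c$ and $\gcd(a,b,c)=1$, we have $\max\{|a|,|b|,|c|\} \le C_\varepsilon P^{1+\varepsilon}$, where $P=\prod_{p\mid abc} p$ is the product of the distinct primes dividing $abc$. Here $\mathbb{Z}_p$ denotes the ring of $p$-adic integers. *)

(* Defs.v *)
From HB Require Import structures.
From mathcomp Require Import all_boot all_order all_algebra.
From mathcomp Require Import finmap.
From mathcomp Require Import all_classical all_reals all_analysis.

Set Implicit Arguments.
Unset Strict Implicit.
Unset Printing Implicit Defensive.

Import Order.TTheory GRing.Theory Num.Theory.
Import numFieldNormedType.Exports.

Local Open Scope classical_set_scope.
Local Open Scope ring_scope.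

(* The ring Z_p is the inverse limit of the rings Z/p^n: an element is the
   family of the least non-negative representatives u n of its images in Z/p^n,
   so that Leibniz equality is equality in Z_p. No primality is needed for the
   construction. It is only a possibly trivial ring (pzRing), since p = 1 gives
   the zero ring; for p prime it is the usual ring of p-adic integers. *)
Record padic_int (p : nat) := PadicInt {
  padic_coord :> nat -> int;
  padic_coordP : forall n,
    padic_coord n = (padic_coord n.+1 %% (p ^ n)%N%:Z)%Z }.

Section PadicRing.
Variable p : nat.
Implicit Types u v w : padic_int p.

HB.instance Definition _ := gen_eqMixin (padic_int p).
HB.instance Definition _ := gen_choiceMixin (padic_int p).

Lemma padic_eqP u v : (forall n, u n = v n) -> u = v.
Proof.
case: u v => [f fP] [g gP] /= /funext fg; subst g.
by congr PadicInt; exact: Prop_irrelevance.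
Qed.

Lemma modz_expS (m : int) n :
  ((m %% (p ^ n.+1)%N%:Z)%Z = m %[mod (p ^ n)%N%:Z])%Z.
Proof.
rewrite [in RHS](divz_eq m (p ^ n.+1)%N%:Z) expnS PoszM mulrA.
by rewrite modzMDl.
Qed.

Lemma padic_modS u n : (u n.+1 = u n %[mod (p ^ n)%N%:Z])%Z.
Proof. by rewrite [in RHS]padic_coordP modz_mod. Qed.

Lemma padic_coord_mod u n : (u n %% (p ^ n)%N%:Z)%Z = u n.
Proof. by rewrite [in LHS]padic_coordP modz_mod -padic_coordP. Qed.

Fact padic_of_int_subproof (m : int) n :
  (m %% (p ^ n)%N%:Z)%Z = ((m %% (p ^ n.+1)%N%:Z)%Z %% (p ^ n)%N%:Z)%Z.
Proof. by rewrite modz_expS. Qed.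

Fact padic_add_subproof u v n :
  ((u n + v n) %% (p ^ n)%N%:Z)%Z =
  (((u n.+1 + v n.+1) %% (p ^ n.+1)%N%:Z)%Z %% (p ^ n)%N%:Z)%Z.
Proof. by rewrite modz_expS -[RHS]modzDm !padic_modS modzDm. Qed.

Fact padic_opp_subproof u n :
  ((- u n) %% (p ^ n)%N%:Z)%Z =
  (((- u n.+1) %% (p ^ n.+1)%N%:Z)%Z %% (p ^ n)%N%:Z)%Z.
Proof. by rewrite modz_expS -[RHS]modzNm padic_modS modzNm. Qed.

Fact padic_mul_subproof u v n :
  ((u n * v n) %% (p ^ n)%N%:Z)%Z =
  (((u n.+1 * v n.+1) %% (p ^ n.+1)%N%:Z)%Z %% (p ^ n)%N%:Z)%Z.
Proof. by rewrite modz_expS -[RHS]modzMm !padic_modS modzMm. Qed.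

Definition padic_of_int (m : int) := PadicInt (padic_of_int_subproof m).
Definition padic_add u v := PadicInt (padic_add_subproof u v).
Definition padic_opp u := PadicInt (padic_opp_subproof u).
Definition padic_mul u v := PadicInt (padic_mul_subproof u v).

Fact padic_addA : associative padic_add.
Proof.
by move=> u v w; apply: padic_eqP => n /=; rewrite modzDmr modzDml addrA.
Qed.

Fact padic_addC : commutative padic_add.
Proof. by move=> u v; apply: padic_eqP => n /=; rewrite addrC. Qed.

Fact padic_add0 : left_id (padic_of_int 0) padic_add.
Proof.
by move=> u; apply: padic_eqP => n /=; rewrite modzDml add0r padic_coord_mod.
Qed.

Fact padic_addN : left_inverse (padic_of_int 0) padic_opp padic_add.
Proof. by move=> u; apply: padic_eqP => n /=; rewrite modzDml addNr. Qed.

HB.instance Definition _ := GRing.isZmodule.Build (padic_int p)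
  padic_addA padic_addC padic_add0 padic_addN.

Fact padic_mulA : associative padic_mul.
Proof.
by move=> u v w; apply: padic_eqP => n /=; rewrite modzMmr modzMml mulrA.
Qed.

Fact padic_mulC : commutative padic_mul.
Proof. by move=> u v; apply: padic_eqP => n /=; rewrite mulrC. Qed.

Fact padic_mul1 : left_id (padic_of_int 1) padic_mul.
Proof.
by move=> u; apply: padic_eqP => n /=; rewrite modzMml mul1r padic_coord_mod.
Qed.

Fact padic_mulDl : left_distributive padic_mul padic_add.
Proof.
move=> u v w; apply: padic_eqP => n /=.
by rewrite modzMml modzDm mulrDl.
Qed.

HB.instance Definition _ := GRing.Zmodule_isComPzRing.Build (padic_int p)
  padic_mulA padic_mulC padic_mul1 padic_mulDl.

Lemma padic_intr (m : int) : m%:~R = padic_of_int m :> padic_int p.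
Proof.
have nat_case k : k%:R = padic_of_int k :> padic_int p.
  elim: k => [|k IH]; first by [].
  rewrite -natr1 IH; apply: padic_eqP => n /=.
  by rewrite modzDm -addn1 PoszD.
case: m => k; first by rewrite -nat_case.
rewrite NegzE mulrNz; apply: padic_eqP => n.
by rewrite -[k.+1%:~R]/(k.+1%:R) nat_case /= modzNm.
Qed.

End PadicRing.

Definition diag_solvable (A : comPzRingType) (k : nat) (a b c : int) : Prop :=
  exists x y z : A, ~ [/\ x = 0, y = 0 & z = 0] /\
    a%:~R * x ^+ k + b%:~R * y ^+ k + c%:~R * z ^+ k = 0.

Definition coef_box (R : realType) (H : R) : set (int * int * int) :=
  [set t | [/\ 0 < `|t.1.1%:~R : R| <= H, 0 < `|t.1.2%:~R : R| <= H
             & 0 < `|t.2%:~R : R| <= H]].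

Lemma finite_coef_box (R : realType) (H : R) : finite_set (coef_box H).
Proof.
have [N HN] : exists N : nat, H <= N%:R.
  exists (Num.bound `|H|); apply: (le_trans (ler_norm H)).
  exact/ltW/archi_boundP.
pose f (t : 'I_N.+1 * bool) : int := (-1) ^+ t.2 * (t.1 : nat)%:Z.
have fI : finite_set (range f) by apply: finite_image; exact: finite_finset.
apply: (@sub_finite_set _ _ ((range f `*` range f) `*` range f)); last first.
  by do !apply: finite_setX.
have fP (m : int) : `|m%:~R : R| <= H -> range f m.
  move=> mH; have mN : (`|m| < N.+1)%N.
    rewrite ltnS -(@ler_nat R); apply: le_trans HN; apply: le_trans mH.
    by rewrite -intr_norm -abszE.
  exists (Ordinal mN, m < 0) => //.
  by rewrite /f /= -intEsign.
by case=> -[a b] c [/= /andP[_ /fP ?] /andP[_ /fP ?] /andP[_ /fP ?]].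
Qed.

(* fset_set is the finite set underlying a finite classical set (the sets
   below are finite by finite_coef_box), so this is a genuine cardinality. *)
Definition M_loc (R : realType) (k : nat) (H : R) : nat :=
  #|` fset_set [set t | coef_box H t /\
      diag_solvable R k t.1.1 t.1.2 t.2 /\
      forall p : nat, prime p ->
        diag_solvable (padic_int p) k t.1.1 t.1.2 t.2] |%fset.

Definition M_glob (R : realType) (k : nat) (H : R) : nat :=
  #|` fset_set [set t | coef_box H t /\
      diag_solvable int k t.1.1 t.1.2 t.2] |%fset.

Definition radical (n : nat) : nat := (\prod_(p <- primes n) p)%N.

(* The radical of 0 is not defined (every prime divides 0), whence the
   condition a * b * c != 0; the excluded coprime triples all have
   max(|a|, |b|, |c|) = 1. *)
Definition abc_conjecture (R : realType) : Prop :=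
  forall eps : R, 0 < eps -> exists C : R, forall a b c : int,
    a + b = c -> gcdz (gcdz a b) c = 1 -> a * b * c != 0 ->
    (Num.max `|a| (Num.max `|b| `|c|))%:~R
      <= C * (radical `|a * b * c|)%:R `^ (1 + eps).

(* Main.v *)
Require Import Defs.
From mathcomp Require Import all_boot all_order all_algebra.
From mathcomp Require Import all_fingroup all_solvable.
From mathcomp Require Import finmap.
From mathcomp Require Import all_classical all_reals all_analysis.
From mathcomp Require Import zify ring lra.
Import Order.TTheory GRing.Theory Num.Theory.
Import numFieldNormedType.Exports.
Local Open Scope classical_set_scope.
Local Open Scope ring_scope.
Set Implicit Arguments.
Unset Strict Implicit.
Unset Printing Implicit Defensive.

(** Idea. The number of globally soluble triples is at most [H ^ (2 + o(1))],
    while at least [H ^ (2 + 1 / (2 k))] triples are locally soluble.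

    Upper bound. Let [(x, y, z)] be a primitive solution with [z] maximal. For
    [z ^ k <= N ^ 2] the triples [(a, b, c)] in the box of side [N] form a plane
    lattice section with [O(N ^ 2 / z ^ k + N)] points, and [k >= 6] makes the sum
    over [(x, y, z)] at most [N ^ 2] up to a logarithm. For [z ^ k > N ^ 2] the
    triple [(a, b, c)] is determined by [(x, y, z)] and [gcd(a, b, c)], and the
    abc-conjecture gives [xyz <= C (N / gcd) ^ (2 + e)].

    Lower bound. Consider the triples [(- p_1 ... p_k, - q_1 ... q_k, m ^ k)] with
    all [p_i, q_j, m <= H ^ (1 / k)], the [p_i] and [q_j] primes. Colour a pair
    [(p, q)] by the class of [q] modulo [k]-th powers mod [p] and the class of [p]
    modulo [k]-th powers mod [q]: a positive proportion of the
    [(p_1, ..., p_k; q_1, ..., q_k)] is monochromatic, and then [q_1 ... q_k] is a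
    [k]-th power mod every [p_i] and vice versa. Small primes are dealt with by
    taking all [p_i] in one residue class to a large modulus (pigeonhole), and the
    remaining primes by counting point-line incidences over [F_p]. *)

(** * Finite counting *)

Lemma leq_expn2r m n e : (m <= n)%N -> (m ^ e <= n ^ e)%N.
Proof. by case: e => [|e] // mn; rewrite leq_exp2r. Qed.

Lemma card_ord_lt m n : (#|[pred p : 'I_n | (p < m)%N]| <= m)%N.
Proof.
rewrite cardE -(size_map val) -[leqRHS](size_iota 0).
apply: uniq_leq_size; first by rewrite (map_inj_uniq val_inj) enum_uniq.
by move=> _ /mapP[p + ->]; rewrite mem_enum mem_iota add0n.
Qed.

(** This bounds [M_loc], the cardinality of an [fset], from below: the triples are parametrised by a
    finite family whose fibres are small. *)
Lemma card_leq_fiber (T : finType) (U : choiceType) (B : {pred T}) (h : T -> U)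
    (K : nat) (S : {fset U}) :
  (forall x, x \in B -> h x \in S) ->
  (forall x, x \in B -> (#|[pred y in B | h y == h x]| <= K)%N) ->
  (#|B| <= K * #|` S|)%N.
Proof.
move=> hS hK.
have -> : #|B| = (\sum_(s <- enum_fset S) #|[pred y in B | h y == s]|)%N.
  under [RHS]eq_bigr => s _ do rewrite -sum1_card.
  rewrite (exchange_big_dep (mem B)) /=; last by move=> s x _ /andP[].
  rewrite -sum1_card; apply: eq_bigr => x xB.
  rewrite sum1_count (eq_count (a2 := pred1 (h x))); last first.
    by move=> s; rewrite !inE xB /= eq_sym.
  by rewrite count_uniq_mem ?fset_uniq // hS.
rewrite mulnC -[X in (_ <= X * _)%N]sum1_size big_distrl /=.
rewrite leq_sum // => s _; rewrite mul1n.
have [->//|] := posnP #|[pred y in B | h y == s]|.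
by case/card_gt0P => x /andP[xB /eqP xs]; rewrite -xs; apply: hK.
Qed.

Lemma card_cover (T I : finType) (S : {pred T}) (J : {pred I}) (F : I -> {pred T}) :
  (forall t, t \in S -> exists2 i, i \in J & t \in F i) ->
  (#|S| <= \sum_(i in J) #|F i|)%N.
Proof.
move=> cover; rewrite -sum1_card.
under [leqRHS]eq_bigr => i _ do rewrite -sum1_card.
rewrite (exchange_big_dep predT) //= [leqRHS](bigID (mem S)) /=.
apply: leq_trans (leq_addr _ _); apply: leq_sum => t tS.
by have [i iJ tF] := cover t tS; rewrite (bigD1 i) ?iJ //= leq_addr.
Qed.

(** * Diagonal curves over finite fields *)

Section Incidence.
Variables (F : finFieldType).
Implicit Types (P L : {pred F * F}).

(** The pair [(m, n)] encodes the line y = m x + n. Vertical lines are left out, so that points and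
    lines are both indexed by [F * F]. *)
Definition incident (l u : F * F) : bool := u.2 == l.1 * u.1 + l.2.

Lemma card_lines_through (u : F * F) :
  (#|[pred l | incident l u]| = #|F|)%N.
Proof.
rewrite -(card_codom (f := fun m : F => (m, u.2 - m * u.1))); last first.
  by move=> m m' [].
apply: eq_card => -[m n]; rewrite !inE /incident /=.
apply/eqP/codomP => [->|[m' [-> ->]]]; last by rewrite addrC subrK.
by exists m; rewrite addrAC subrr add0r.
Qed.

Lemma card_lines_through2 (u v : F * F) : u != v ->
  (#|[pred l | incident l u && incident l v]| <= 1)%N.
Proof.
move=> uv; apply/card_le1_eqP => -[m n] [m' n'].
rewrite !inE /incident /=; case: u v uv => [x y] [x' y'] /=.
move=> uv /andP[/eqP e1 /eqP e2] /andP[/eqP e3 /eqP e4].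
have x_neq : x - x' != 0.
  apply: contra uv; rewrite subr_eq0 => /eqP xx'.
  by apply/eqP; congr pair => //; rewrite e1 e2 xx'.
have /eqP : (m - m') * (x - x') = 0.
  have -> : (m - m') * (x - x') = (m * x + n) - (m' * x + n')
    - ((m * x' + n) - (m' * x' + n')) by ring.
  by rewrite -e1 -e2 -e3 -e4; ring.
rewrite mulf_eq0 (negbTE x_neq) orbF subr_eq0 => /eqP mm'.
congr pair => //; move: e3; rewrite e1 mm' => /addrI; exact.
Qed.

Lemma sum_incidences P :
  (\sum_l #|[pred u in P | incident l u]| = #|F| * #|P|)%N.
Proof.
under eq_bigr => l _ do rewrite -sum1_card.
rewrite (exchange_big_dep (mem P)) /=; last by move=> l u _ /andP[].
rewrite mulnC -sum_nat_const; apply: eq_bigr => u uP.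
rewrite -(card_lines_through u) -sum1_card; apply: eq_bigl => l.
by rewrite !inE uP.
Qed.

(** The square counts ordered pairs of points of [P] on a common line. Equal points contribute
    [#|F|] lines each, and distinct points at most one line. *)
Lemma sum_incidences_sqr P :
  (\sum_l #|[pred u in P | incident l u]| ^ 2 <= #|F| * #|P| + #|P| ^ 2)%N.
Proof.
have -> : (\sum_l #|[pred u in P | incident l u]| ^ 2 =
   \sum_(u in P) \sum_(v in P) #|[pred l | incident l u && incident l v]|)%N.
  transitivity (\sum_l \sum_(u in P) \sum_(v in P)
      (incident l u && incident l v : nat))%N.
    apply: eq_bigr => l _; rewrite -mulnn -!sum1_card big_distrl /=.
    rewrite big_mkcondr; apply: eq_bigr => u uP.
    case: (incident l u); last by rewrite big1.
    by rewrite mul1n big_mkcondr; apply: eq_bigr => v _; case: ifP.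
  rewrite exchange_big; apply: eq_bigr => u uP.
  rewrite exchange_big; apply: eq_bigr => v vP.
  by rewrite -sum1_card [RHS]big_mkcond; apply: eq_bigr => l _; rewrite !inE; case: ifP.
rewrite mulnC -mulnn -2!sum_nat_const -big_split /=.
apply: leq_sum => u uP; rewrite (bigD1 u) //= leq_add //.
  rewrite -(card_lines_through u); apply: subset_leq_card.
  by apply/fintype.subsetP => l; rewrite !inE => /andP[].
rewrite -sum1_card [leqRHS](bigD1 u) //= (leq_trans _ (leq_addl _ _)) //.
by apply: leq_sum => v /andP[_ vu]; apply: card_lines_through2; rewrite eq_sym.
Qed.

(* Second moment over all lines: the number of points of [P] on a random line
   has mean [#|P| / #|F|] and small variance. *)
Lemma incidence_free_bound P L :
  {in L & P, forall l u, ~~ incident l u} -> (#|L| * #|P| <= #|F| ^ 3)%N.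
Proof.
move=> free; have [->|P_gt0] := posnP #|P|; first by rewrite muln0.
pose q : int := #|F|%:Z; pose s : int := #|P|%:Z.
pose I l : int := #|[pred u in P | incident l u]|%:Z.
have sumI : \sum_l I l = q * s.
  by rewrite -PoszM -sum_incidences [RHS](big_morph Posz PoszD (erefl _)).
have sumI2 : \sum_l I l ^+ 2 <= q * s + s ^+ 2.
  have := sum_incidences_sqr P; rewrite -lez_nat PoszD PoszM.
  rewrite (big_morph Posz PoszD (erefl _)).
  under eq_bigr => l _ do rewrite -mulnn PoszM -expr2.
  by rewrite -mulnn PoszM -expr2.
(* The deviation from the mean is scaled by [q] to stay in the integers. A line of [L] meets no
   point of [P], so its deviation is exactly [- s]. *)
have : \sum_(l in L) s ^+ 2 <= \sum_l (q * I l - s) ^+ 2.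
  rewrite [leRHS](bigID (mem L)) /= -[leLHS]addr0 lerD //; last first.
    by apply: sumr_ge0 => l _; apply: sqr_ge0.
  apply: ler_sum => l lL; rewrite (_ : I l = 0) ?mulr0 ?sub0r ?sqrrN //.
  rewrite /I eq_card0 // => u; rewrite !inE; apply/negP => /andP[uP].
  exact/negP/free.
rewrite sumr_const.
have -> : \sum_l (q * I l - s) ^+ 2 =
    q ^+ 2 * (\sum_l I l ^+ 2) - 2 * q * s * (\sum_l I l) + q ^+ 2 * s ^+ 2.
  under eq_bigr => l _ do rewrite sqrrB exprMn.
  rewrite !big_split /= -mulr_sumr sumr_const card_prod; congr (_ + _ + _).
    by rewrite sumrN mulr_sumr; congr (- _); apply: eq_bigr => l _; ring.
  by rewrite -mulr_natl natrM [q ^+ 2]expr2 /q !natz.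
rewrite sumI => h.
have {h} : s ^+ 2 *+ #|L| <= q ^+ 3 * s.
  apply: le_trans h _; rewrite -subr_ge0.
  have -> : q ^+ 3 * s - (q ^+ 2 * (\sum_l I l ^+ 2) - 2 * q * s * (q * s) +
     q ^+ 2 * s ^+ 2) = q ^+ 2 * (q * s + s ^+ 2 - \sum_l I l ^+ 2) by ring.
  by rewrite mulr_ge0 ?sqr_ge0 // subr_ge0.
have s_gt0 : 0 < s by rewrite ltz_nat.
by rewrite -mulr_natl natz expr2 mulrA ler_pM2r.
Qed.

Variable k : nat.
Hypothesis k_gt0 : (0 < k)%N.

Definition nz_powers : {pred F} := [pred x | [exists y, (y != 0) && (x == y ^+ k)]].

(** A fibre of y -> y^k consists of roots of X^k - x, hence has at most [k] elements. *)
Lemma nz_powers_card : (#|F|.-1 <= k * #|nz_powers|)%N.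
Proof.
have -> : (#|F|.-1 = #|[pred y : F | y != 0%R]|)%N.
  by rewrite -(cardC1 (0 : F)); apply: eq_card => y; rewrite !inE.
rewrite -sum1_card (partition_big (fun y => y ^+ k) (mem nz_powers)) /=.
  rewrite mulnC -sum_nat_const; apply: leq_sum => x _.
  rewrite sum1_card cardE.
  have Xk : 'X^k - x%:P != 0 :> {poly F} by rewrite -size_poly_eq0 size_XnsubC.
  have := @max_poly_roots _ ('X^k - x%:P) (enum [pred y | (y != 0) && (y ^+ k == x)]) Xk.
  rewrite size_XnsubC // ltnS; apply; last exact: enum_uniq.
  apply/allP => y; rewrite mem_enum inE => /andP[_ /eqP yx].
  by rewrite /root !hornerE yx subrr.
by move=> y y0; rewrite inE; apply/existsP; exists y; rewrite eqxx andbT.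
Qed.

(** Points are pairs of nonzero k-th powers (x^k, y^k), and lines are pairs (m, n) with - (b / a) m
    = w^k and b n = z^k. An incidence y^k = m x^k + n says a (w x)^k + b y^k = z^k. Without
    solutions there are no incidences, yet both sets have at least ((q - 1) / k)^2 elements, q =
    [#|F|], against [incidence_free_bound]. *)
Lemma diag_curve_point (a b : F) : a != 0 -> b != 0 ->
  (k ^ 4 * #|F| ^ 3 < #|F|.-1 ^ 4)%N ->
  exists x y z : F, z != 0 /\ a * x ^+ k + b * y ^+ k = z ^+ k.
Proof.
move=> a0 b0 big; apply: contrapT => nosol.
pose P : {pred F * F} := [pred u | (u.1 \in nz_powers) && (u.2 \in nz_powers)].
pose L : {pred F * F} := [pred l | (- (b / a) * l.1 \in nz_powers) &&
                             (b * l.2 \in nz_powers)].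
have nzK : (#|P| = #|nz_powers| ^ 2)%N.
  by rewrite -mulnn -cardX; apply: eq_card => -[u v]; rewrite !inE.
have nzL : (#|L| = #|nz_powers| ^ 2)%N.
  rewrite -nzK.
  (* The linear change of coordinates carrying [P] onto [L]. *)
  pose h (u : F * F) : F * F := (- (a / b) * u.1, b^-1 * u.2).
  have hI : injective h.
    move=> [u v] [u' v'] [] /mulfI-> //; last by rewrite oppr_eq0 mulf_neq0 ?invr_eq0.
    by move=> /mulfI-> //; rewrite invr_eq0.
  rewrite -[RHS](fintype.card_image hI); apply: eq_card => -[m n]; rewrite [LHS]inE /=.
  apply/idP/fintype.imageP => [hmn|[[u v] uv [-> ->]]].
    exists (- (b / a) * m, b * n); first by rewrite inE.
    rewrite /h /= mulKf // mulrA mulrNN; congr pair.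
    by rewrite [X in X * m](_ : _ = 1) ?mul1r //; field; rewrite a0 b0.
  rewrite /= mulrA mulrNN mulVKf // [X in X * u](_ : _ = 1) ?mul1r //.
  by field; rewrite a0 b0.
have : (#|L| * #|P| <= #|F| ^ 3)%N.
  apply: incidence_free_bound => -[m n] [X Y] /andP[/=].
  move=> /existsP[w /andP[w0 /eqP we]] /existsP[z /andP[z0 /eqP ze]].
  move=> /andP[/existsP[x /andP[x0 /eqP /= ->]] /existsP[y /andP[y0 /eqP /= ->]]].
  apply/negP => /eqP /= e; apply: nosol; exists (w * x), y, z; split => //.
  rewrite exprMn -we -ze e; field; exact: a0.
rewrite nzK nzL -expnD => h.
have := nz_powers_card; rewrite -(@leq_exp2r _ _ 4) // => h2.
have := leq_trans big (leq_trans h2 _); rewrite expnMn.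
by move=> /(_ (k ^ 4 * #|F| ^ 3)%N); rewrite ltnn leq_mul2l h orbT => /(_ isT).
Qed.

End Incidence.

(** * Congruences modulo primes and k-th power classes *)

Section PrimeModuli.
Local Open Scope nat_scope.

Lemma Fp_eq_mod p m n : prime p -> (m%:R = n%:R :> 'F_p)%R <-> m = n %[mod p].
Proof.
move=> p_pr; rewrite -(Fp_nat_mod p_pr m) -(Fp_nat_mod p_pr n); split.
  move/(congr1 val); rewrite /= !val_Fp_nat //.
  by rewrite !modn_mod.
by move=> ->.
Qed.

Lemma Fp_eq0_dvd p n : prime p -> (n%:R == 0 :> 'F_p)%R = (p %| n).
Proof. by move=> p_pr; rewrite -(dvdn_pcharf (pchar_Fp p_pr)). Qed.

Lemma Fp_natE p (x : 'F_p) : exists n, x = n%:R%R.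
Proof. by exists x; rewrite natr_Zp. Qed.

(** The constant 16 comes from p <= 2 (p - 1): then k^4 p^3 < p^4 / 16 <= (p - 1)^4, as
    [diag_curve_point] requires. *)
Lemma diag_curve_point_mod k p a b : 0 < k -> prime p -> 16 * k ^ 4 < p ->
  ~~ (p %| a) -> ~~ (p %| b) ->
  exists x y r, ~~ (p %| r) /\ a * x ^ k + b * y ^ k = r ^ k %[mod p].
Proof.
move=> k0 p_pr p_big pa pb.
have [|||x [y [z [z0 e]]]] := @diag_curve_point _ k k0 (a%:R : 'F_p)%R (b%:R)%R.
- by rewrite Fp_eq0_dvd.
- by rewrite Fp_eq0_dvd.
- rewrite card_Fp //.
  have p2 : p <= 2 * p.-1 by case: p p_pr {p_big pa pb} => [|[|p]] //=; lia.
  rewrite -(ltn_pmul2l (isT : 0 < 2 ^ 4)).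
  have : p ^ 4 <= 2 ^ 4 * p.-1 ^ 4 by rewrite -expnMn leq_exp2r.
  apply: leq_trans; rewrite mulnA expnS ltn_pmul2r ?expn_gt0 ?prime_gt0 //.
have [m em] := Fp_natE x; have [n en] := Fp_natE y; have [r er] := Fp_natE z.
exists m, n, r; split; first by rewrite -Fp_eq0_dvd // -er.
by apply/(Fp_eq_mod _ _ p_pr); rewrite natrD !natrM !natrX -em -en -er.
Qed.

(** The colour is the discrete logarithm modulo [k] with respect to a generator of the cyclic group
    of units. A product of [k] factors of the same colour has logarithm divisible by [k]. *)
Lemma power_class_coloring k p : 0 < k -> prime p ->
  exists f : nat -> 'I_k, forall (q : 'I_k -> nat) c,
    (forall i, ~~ (p %| q i)) -> (forall i, f (q i) = c) ->
    exists r, ~~ (p %| r) /\ \prod_i q i = r ^ k %[mod p].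
Proof.
move=> k0 p_pr.
have [g gP] : exists g : 'F_p, forall x : 'F_p, x != 0%R -> exists i, x == (g ^+ i)%R.
  have /cyclicP[g ge] := field_unit_group_cyclic [set: {unit 'F_p}]%G.
  exists (val g) => x x0; have xu : (x \is a GRing.unit)%R by rewrite unitfE.
  have : FinRing.unit 'F_p xu \in [set: {unit 'F_p}]%G by rewrite inE.
  rewrite /= ge => /cycleP[i /(congr1 val)] /= e; exists i; apply/eqP.
  by rewrite e FinRing.val_unitX.
(* By [gP] the default value 0 can only occur when [p] divides [n], which the hypothesis on [q]
   excludes. *)
pose dlog n := if pselect (exists i, (n%:R : 'F_p)%R == (g ^+ i)%R) is left h
   then xchoose h else 0.
exists (fun n => Ordinal (ltn_pmod (dlog n) k0)) => q c qn0 fc.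
have dlogP i : (q i)%:R%R = (g ^+ dlog (q i))%R.
  rewrite /dlog; case: pselect => [h|[]]; first exact/eqP/(xchooseP h).
  by apply: gP; rewrite Fp_eq0_dvd.
have prodE : ((\prod_i q i)%:R = (g ^+ (\sum_i dlog (q i))%N : 'F_p))%R.
  by rewrite natr_prod -prodrXr; apply: eq_bigr => i _; rewrite dlogP.
have /dvdnP[s se] : k %| \sum_i dlog (q i).
  rewrite /dvdn -modn_summ.
  have -> : \sum_i dlog (q i) %% k = \sum_(i < k) c.
    by apply: eq_bigr => i _; rewrite -(fc i).
  by rewrite sum_nat_const card_ord modnMr.
have [r re] := Fp_natE (g ^+ s)%R; exists r.
have rk : \prod_i q i = r ^ k %[mod p].
  by apply/(Fp_eq_mod _ _ p_pr); rewrite prodE se natrX -re exprM.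
split=> //; apply/negP => pr.
have : (((\prod_i q i)%:R : 'F_p) != 0)%R.
  by rewrite natr_prod; apply/prodf_neq0 => i _; rewrite Fp_eq0_dvd.
by rewrite Fp_eq0_dvd // /dvdn rk -[_ == 0]/(p %| r ^ k) dvdn_exp.
Qed.
End PrimeModuli.

(** * Hensel lifting of roots to p-adic integers *)

Section Hensel.
Variables (p k : nat).
Hypothesis p_pr : prime p.

(** Newton's step. The derivative k t^(k-1) has valuation exactly [v], so adding p^(n-v) s to [t]
    changes t^k by p^n k' t^(k-1) s modulo p^(2(n-v)), and 2 (n - v) > n. A suitable [s] then
    cancels the error modulo p^(n+1). *)
Lemma root_lift_step (v k' : nat) (u t : int) (n : nat) :
  k = (p ^ v * k')%N -> ~~ (p %| k')%N -> ~~ (p %| t)%Z -> (2 * v < n)%N ->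
  ((p ^ n)%N %| t ^+ k - u)%Z ->
  exists s : int, ((p ^ n.+1)%N %| (t + (p ^ (n - v))%N%:Z * s) ^+ k - u)%Z.
Proof.
move=> ek pk' pt vn /dvdzP[e ee].
have cop : coprimez (k'%:Z * t ^+ k.-1) p%:Z.
  rewrite coprimezE abszM coprimeMl; apply/andP; split.
    by rewrite coprime_sym prime_coprime.
  by rewrite abszX coprimeXl // coprime_sym prime_coprime.
have /coprimezP[[w1 w2] /= bez] := cop.
(* The error is e p^n, and [w1] is the inverse of k' t^(k-1) modulo [p]. *)
exists (- e * w1).
pose h : int := (p ^ (n - v))%N%:Z * (- e * w1).
have [r hr] : exists r : int, (t + h) ^+ k = t ^+ k + h * t ^+ k.-1 *+ k + h ^+ 2 * r.
  case: (k) => [|k0]; first by exists 0; rewrite !expr0 mulr0n mulr0 !addr0.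
  exists (\sum_(i < k0) t ^+ (k0 - i.+1) * h ^+ i *+ 'C(k0.+1, i.+2)).
  rewrite exprDn big_ord_recl big_ord_recl /= !subn0 expr0 mulr1 bin0 mulr1n.
  rewrite subn1 /= expr1 bin1 -addrA; congr (_ + (_ + _)).
    by rewrite mulrC.
  rewrite mulr_sumr; apply: eq_bigr => i _.
  rewrite /bump /= !add1n subSS mulrnAr; congr (_ *+ _).
  by rewrite [RHS]mulrCA -exprD.
have -> : (t + h) ^+ k - u = (t ^+ k - u) + h * t ^+ k.-1 *+ k + h ^+ 2 * r.
  by rewrite hr; ring.
have vn' : (v <= n)%N by clear -vn; lia.
have pn : ((p ^ n)%N%:Z = (p ^ (n - v))%N%:Z * (p ^ v)%N%:Z).
  by rewrite -PoszM -expnD subnK.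
rewrite ee rpredD //; last first.
  rewrite /h exprMn -mulrA dvdz_mulr // expr2 -PoszM -expnD dvdzE /=.
  by apply: dvdn_exp2l; clear -vn; lia.
have -> : e * (p ^ n)%N%:Z + h * t ^+ k.-1 *+ k =
          (p ^ n)%N%:Z * (e * (1 - w1 * (k'%:Z * t ^+ k.-1))).
  rewrite -mulr_natl natz [in X in X%:Z * _]ek PoszM /h pn; ring.
rewrite -bez expnSr PoszM dvdz_mul // (_ : _ - _ = w2 * p%:Z); last by ring.
by rewrite mulrA dvdz_mull.
Qed.

Lemma root_approximations (u r : int) :
  (0 < k)%N -> ~~ (p %| r)%Z ->
  ((p ^ (2 * logn p k).+1)%N %| r ^+ k - u)%Z ->
  exists t : nat -> int, forall n,
    ((p ^ n)%N %| t n ^+ k - u)%Z /\ ((p ^ n)%N %| t n.+1 - t n)%Z.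
Proof.
move=> k0 pr hr; have [k' copk' ek] := pfactor_coprime p_pr k0.
have pk' : ~~ (p %| k')%N by rewrite -prime_coprime.
rewrite mulnC in ek; set v := logn p k in hr ek.
(* [m j] is the precision after [j] steps. It always exceeds 2 v, as the lifting step needs, and the
   next correction is divisible by p^(m j - v) with m j - v > j. *)
pose m j := ((2 * v).+1 + j)%N.
(* The conditions on [x] are placed under the existential so that [choice] applies to all pairs. *)
have step (x : nat * int) : exists s : int, ~~ (p %| x.2)%Z ->
    ((p ^ m x.1)%N %| x.2 ^+ k - u)%Z ->
    ((p ^ m x.1.+1)%N %| (x.2 + (p ^ (m x.1 - v))%N%:Z * s) ^+ k - u)%Z.
  have [hx|hx] := boolP (~~ (p %| x.2)%Z && ((p ^ m x.1)%N %| x.2 ^+ k - u)%Z).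
    case/andP: hx => h1 h2.
    have [|s hs] := root_lift_step ek pk' h1 _ h2; first by rewrite /m; clear; lia.
    by exists s => _ _; rewrite /m addnS.
  by exists 0 => h1 h2; rewrite h1 h2 in hx.
have [f fP] := choice step.
pose w := fix w n : int := if n is n'.+1
  then w n' + (p ^ (m n' - v))%N%:Z * f (n', w n') else r.
have wP n : ~~ (p %| w n)%Z /\ ((p ^ m n)%N %| w n ^+ k - u)%Z.
  elim: n => [|n [IH1 IH2]]; first by split=> //; rewrite /m addn0.
  split; last exact: (fP (n, w n) IH1 IH2).
  rewrite [w n.+1]/= rpredDr // dvdz_mulr // dvdzE /= dvdn_exp //.
  by rewrite /m; clear; lia.
exists w => n; split.
  have [_] := wP n; apply: dvdz_trans.
  by rewrite dvdzE /= dvdn_exp2l // /m leq_addl.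
rewrite [w n.+1]/= addrAC subrr add0r dvdz_mulr // dvdzE /= dvdn_exp2l //.
by rewrite /m; clear; lia.
Qed.

Lemma padic_coordXn (x : padic_int p) n i :
  ((x ^+ i) n = x n ^+ i %[mod (p ^ n)%N%:Z])%Z.
Proof.
elim: i => [|i IH].
  by rewrite !expr0 -[1 in LHS]/(padic_of_int p 1) /= modz_mod.
rewrite !exprS -[_ * x ^+ i]/(padic_mul _ _) /= modz_mod.
by rewrite -modzMmr IH modzMmr.
Qed.

(** The approximate roots form a Cauchy sequence, so their residues modulo p^n are coherent and
    define an element of the inverse limit. *)
Lemma padic_root (u r : int) :
  (0 < k)%N -> ~~ (p %| r)%Z ->
  ((p ^ (2 * logn p k).+1)%N %| r ^+ k - u)%Z ->
  exists t : padic_int p, t ^+ k = u%:~R.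
Proof.
move=> k0 pr /(root_approximations k0 pr)[t tP].
have tmod n : (t n %% (p ^ n)%N%:Z)%Z =
    ((t n.+1 %% (p ^ n.+1)%N%:Z)%Z %% (p ^ n)%N%:Z)%Z.
  rewrite modz_expS; apply/esym/eqP; rewrite eqz_mod_dvd.
  by have [] := tP n.
exists (PadicInt tmod); rewrite padic_intr; apply: padic_eqP => n.
rewrite -padic_coord_mod padic_coordXn /= modzXm.
by apply/eqP; rewrite eqz_mod_dvd; have [] := tP n.
Qed.

Lemma padic_int_neq0 (u : int) : ~~ (p %| u)%Z -> u%:~R <> 0 :> padic_int p.
Proof.
move=> pu; rewrite padic_intr => /(congr1 (fun x : padic_int p => x 1%N)) /=.
by rewrite expn1 mod0z => /dvdz_mod0P; apply/negP.
Qed.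

End Hensel.

(** * Chebyshev's lower bound for the number of primes *)

Section Chebyshev.
Local Open Scope nat_scope.

Lemma exp2_leq_central_bin n : 2 ^ n <= 'C(n.*2, n).
Proof.
elim: n => [|n IH] //; rewrite doubleS binS expnS mul2n -addnn.
rewrite -(bin_sub (n := n.*2.+1) (m := n.+1)); last by lia.
have -> : n.*2.+1 - n.+1 = n by lia.
have h : 'C(n.*2, n) <= 'C(n.*2.+1, n) by case: n {IH} => // n; rewrite binS leq_addr.
by apply: leq_add; apply: leq_trans h.
Qed.

(** By Legendre's formula the valuation is the sum of floor(2n / p^i) - 2 floor(n / p^i). Each term
    is at most 1 and vanishes once p^i > 2n. *)
Lemma logn_central_bin p n : prime p -> logn p 'C(n.*2, n) <= trunc_log p n.*2.
Proof.
move=> p_pr; have [->|n0] := posnP n; first by rewrite bin0 logn1.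
have n2 : n <= n.*2 by rewrite -addnn leq_addr.
have : logn p (n.*2)`! = logn p 'C(n.*2, n) + 2 * logn p n`!.
  rewrite -(bin_fact n2) lognM ?bin_gt0 ?muln_gt0 ?fact_gt0 //.
  have -> : n.*2 - n = n by lia.
  by rewrite lognM ?fact_gt0 // mul2n addnn.
rewrite !logn_fact // => e.
(* Both sums must run over the same exponents; the added terms vanish because n < p^i. *)
have ext : \sum_(1 <= i < n.+1) n %/ p ^ i = \sum_(1 <= i < n.*2.+1) n %/ p ^ i.
  rewrite [RHS](big_cat_nat (n := n.+1)) //= [X in _ + X]big1_seq ?addn0 //.
  move=> i /andP[_]; rewrite mem_index_iota => /andP[ni _].
  by rewrite divn_small // (leq_trans ni) // ltnW // ltn_expl // prime_gt1.
rewrite ext in e.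
have : \sum_(1 <= i < n.*2.+1) n.*2 %/ p ^ i <=
       \sum_(1 <= i < n.*2.+1) (2 * (n %/ p ^ i) + (i <= trunc_log p n.*2)).
  rewrite big_nat_cond [leqRHS]big_nat_cond; apply: leq_sum => i /andP[/andP[i0 _] _].
  have pi0 : 0 < p ^ i by rewrite expn_gt0 prime_gt0.
  case: (leqP i (trunc_log p n.*2)) => hi.
    rewrite -ltnS ltn_divLR // addn1.
    have : n.*2 = 2 * (n %/ p ^ i * p ^ i + n %% p ^ i) by rewrite -divn_eq mul2n.
    have := ltn_pmod n pi0; move: (p ^ i) (n %/ p ^ i) (n %% p ^ i) => c b a; clear; nia.
  rewrite addn0 divn_small // (leq_trans (trunc_log_ltn _ (prime_gt1 p_pr))) //.
  by rewrite leq_exp2l // prime_gt1.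
rewrite e big_split /= -big_distrr /= addnC leq_add2l => /leq_trans; apply.
rewrite -big_mkcond /= sum1_count -size_filter.
have -> : trunc_log p n.*2 = size (iota 1 (trunc_log p n.*2)) by rewrite size_iota.
apply: uniq_leq_size; first by rewrite filter_uniq // iota_uniq.
move=> i; rewrite mem_filter mem_iota mem_index_iota size_iota.
by clear; lia.
Qed.

Lemma prime_dvd_fact p n : prime p -> p %| n`! -> p <= n.
Proof.
move=> p_pr; elim: n => [|n IH]; first by rewrite dvdn1 => /eqP p1; rewrite p1 in p_pr.
by rewrite factS Euclid_dvdM // => /orP[/dvdn_leq->//|/IH/leqW].
Qed.

(** The central binomial coefficient is at least 2^n. It is a product of prime powers, each at most
    2n by [logn_central_bin], over primes up to 2n. *)
Lemma exp2_leq_prime_count n : 0 < n ->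
  2 ^ n <= n.*2 ^ #|[pred p : 'I_n.*2.+1 | prime p]|.
Proof.
move=> n0; apply: leq_trans (exp2_leq_central_bin n) _.
set C := 'C(_, _); have C0 : 0 < C by rewrite bin_gt0; lia.
have n20 : 0 < n.*2 by rewrite double_gt0.
rewrite [leqLHS](prod_prime_decomp C0) prime_decompE big_map /=.
apply: (@leq_trans (\prod_(p <- primes C) n.*2)).
  rewrite !big_seq; elim/big_ind2: _ => // [a b c d|p]; first exact: leq_mul.
  rewrite mem_primes => /and3P[p_pr _ _].
  apply: leq_trans (trunc_logP (prime_gt1 p_pr) n20).
  by rewrite leq_exp2l ?prime_gt1 // logn_central_bin.
rewrite big_const_seq count_predT -Monoid.iteropE /=.
rewrite [iterop _ _ _ _](_ : _ = n.*2 ^ size (primes C)) // leq_pexp2l //.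
rewrite cardE -(size_map val); apply: uniq_leq_size (primes_uniq _) _ => p.
rewrite mem_primes => /and3P[p_pr _ pC].
have pn : p < n.*2.+1.
  rewrite ltnS (prime_dvd_fact p_pr) // -(bin_fact (n := n.*2) (m := n)).
    exact: dvdn_mulr.
  by rewrite -addnn leq_addr.
by apply/mapP; exists (Ordinal pn); rewrite ?mem_enum ?inE.
Qed.
End Chebyshev.

(** * Monochromatic complete bipartite subgraphs *)

Section MonochromaticBicliques.
Local Open Scope nat_scope.
Variables (T C : finType) (k : nat) (color : T -> T -> C).
Variables (P Q : {pred T}).

Lemma popular_value (U : finType) (A : {pred U}) (f : U -> C) :
  0 < #|A| -> exists c, #|A| <= #|C| * #|[pred x in A | f x == c]|.
Proof.
move=> /card_gt0P[x0 x0A]; pose n c := #|[pred x in A | f x == c]|.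
pose c0 := [arg max_(c > f x0) n c].
exists c0; rewrite -sum1_card (partition_big f predT) //=.
rewrite -sum_nat_const; apply: leq_sum => c _; rewrite sum1_card.
by rewrite /c0; case: arg_maxnP => // c1 _; apply.
Qed.

Definition bicliques (c : C) : {pred {ffun 'I_k -> T} * {ffun 'I_k -> T}} :=
  [pred w : {ffun 'I_k -> T} * {ffun 'I_k -> T} |
    [forall i, w.1 i \in P] && [forall j, w.2 j \in Q] &&
    [forall i, forall j, color (w.1 i) (w.2 j) == c]].

(** Let [c] be a colour that is most popular at many vertices p of [P]. Each such p is joined in
    colour [c] to at least [#|Q| / #|C|] vertices, so a k-tuple in [Q] has on average at least
    [#|P| / #|C| ^ k.+1] common neighbours. A positive proportion of the tuples reach half of this
    average, and each of them extends to a biclique by any k-tuple of its common neighbours. *)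
Lemma many_bicliques : 0 < #|P| -> 0 < #|Q| -> exists c,
  #|P| ^ k * #|Q| ^ k <= (2 * #|C| ^ k.+1) ^ k.+1 * #|bicliques c|.
Proof.
move=> P_gt0 Q_gt0.
have [u uP] := choice (fun p => popular_value (color p) Q_gt0).
have [c cP] := popular_value u P_gt0; exists c.
pose nbr p : {pred T} := [pred q in Q | color p q == c].
pose tup : {pred {ffun 'I_k -> T}} := ffun_on (mem Q).
pose common (w : {ffun 'I_k -> T}) : {pred T} :=
  [pred p in P | [forall j, color p (w j) == c]].
have deg_sum : #|P| * #|Q| ^ k <= #|C| ^ k.+1 * \sum_(w in tup) #|common w|.
  have -> : \sum_(w in tup) #|common w| = \sum_(p in P) #|nbr p| ^ k.
    under eq_bigr => w _ do rewrite -sum1_card.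
    rewrite (exchange_big_dep (mem P)) /=; last by move=> w p _ /andP[].
    apply: eq_bigr => p pP.
    rewrite -[X in _ ^ X]card_ord -card_ffun_on -sum1_card.
    apply: eq_bigl => w; rewrite !inE pP /=.
    apply/andP/ffun_onP => [[/ffun_onP wQ /forallP wc] j|h].
      by rewrite inE wc andbT; exact: wQ.
    split; last by apply/forallP => j; have /andP[] := h j.
    by apply/ffun_onP => j; have /andP[] := h j.
  apply: leq_trans (leq_mul cP (leqnn _)) _.
  rewrite expnS -!mulnA leq_mul2l; apply/orP; right.
  rewrite big_distrr /= -sum_nat_const.
  rewrite [leqRHS](bigID (fun p => u p == c)) /= (leq_trans _ (leq_addr _ _)) //.
  apply: leq_sum => p /andP[_ /eqP pc].
  by have := uP p; rewrite pc -expnMn => /leq_expn2r; apply.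
(* The factor 2 makes the tuples outside [good] account for at most half of the double count. *)
set D := 2 * #|C| ^ k.+1.
pose good : {pred {ffun 'I_k -> T}} := [pred w in tup | #|P| <= D * #|common w|].
have tup_good w : (w \in tup) && (w \in good) = (w \in good).
  by rewrite andbC; apply: andb_idr => /andP[].
have tup_card : #|tup| = #|Q| ^ k by rewrite card_ffun_on card_ord.
have good_many : #|Q| ^ k <= D * #|good|.
  rewrite -(leq_pmul2l P_gt0) -(leq_add2r (#|P| * #|Q| ^ k)).
  have -> : #|P| * #|Q| ^ k + #|P| * #|Q| ^ k = 2 * (#|P| * #|Q| ^ k).
    by rewrite mul2n addnn.
  apply: leq_trans (leq_mul (leqnn 2) deg_sum) _; rewrite mulnA -/D.
  rewrite (bigID (mem good)) /= mulnDr leq_add //.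
    rewrite mulnCA leq_mul2l; apply/orP; right; rewrite mulnC -sum_nat_const.
    rewrite (eq_bigl (mem good)); last exact: tup_good.
    apply: leq_sum => w _; apply: subset_leq_card.
    by apply/fintype.subsetP => p /andP[].
  rewrite -tup_card [leqRHS]mulnC -sum_nat_const big_distrr /=.
  rewrite [leqRHS](bigID (mem good)) /= (leq_trans _ (leq_addl _ _)) //.
  by apply: leq_sum => w; rewrite !inE => /andP[-> /=]; rewrite -ltnNge => /ltnW.
have -> : #|bicliques c| = \sum_(w in tup) #|common w| ^ k.
  under eq_bigr => w _ do rewrite -[X in _ ^ X]card_ord -card_ffun_on -sum1_card.
  rewrite pair_big_dep -sum1_card /=.
  rewrite (reindex_inj (h := fun x => (x.2, x.1))); last by move=> [? ?] [? ?] [-> ->].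
  apply: eq_bigl => -[v w] /=; rewrite !inE /=.
  apply/andP/andP => [[/andP[/forallP wP /forallP vQ] /forallP h]|[vQ wP]].
    split; first by apply/ffun_onP => j; exact: vQ.
    by apply/ffun_onP => i; rewrite inE wP /=; exact: h.
  split; last first.
    by apply/forallP => i; have := ffun_onP wP i; rewrite inE => /andP[].
  apply/andP; split; last by apply/forallP => j; exact: (ffun_onP vQ).
  by apply/forallP => i; have := ffun_onP wP i; rewrite inE => /andP[].
apply: leq_trans (leq_mul (leqnn _) good_many) _.
rewrite mulnCA expnS -mulnA leq_mul2l; apply/orP; right.
rewrite [leqLHS]mulnC -sum_nat_const big_distrr /=.
rewrite [leqRHS](bigID (mem good)) /= (leq_trans _ (leq_addr _ _)) //.
rewrite [leqRHS](eq_bigl (mem good)); last exact: tup_good.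
by apply: leq_sum => w /andP[_ h]; rewrite -expnMn leq_expn2r.
Qed.
End MonochromaticBicliques.

(** * Many everywhere locally soluble triples *)

Section LocalFamily.
Variable k : nat.
Hypothesis k_gt0 : (0 < k)%N.

(** The point is (m x, m y, t) with t^k = a x^k + b y^k. The root [t] exists by Hensel's lemma and
    is nonzero because [p] does not divide [r]. *)
Lemma padic_solvable_family (p a b m x y r : nat) : prime p -> (0 < m)%N ->
  ~~ (p %| r)%N ->
  a * x ^ k + b * y ^ k = r ^ k %[mod p ^ (2 * logn p k).+1] ->
  diag_solvable (padic_int p) k (- a%:Z) (- b%:Z) (m ^ k)%N%:Z.
Proof.
move=> p_pr m0 pr e; set u := (a * x ^ k + b * y ^ k)%N in e.
have [||t ht] := @padic_root p k p_pr u%:Z r%:Z k_gt0; first by rewrite dvdzE.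
  rewrite -rmorphXn /= -eqz_mod_dvd !modz_nat e //.
have tn0 : t <> 0.
  move=> t0; have : ~~ (p %| u%:Z)%Z.
    rewrite dvdzE /=; apply/negP => pu.
    have : (p %| r ^ k)%N.
      have pd : (p %| p ^ (2 * logn p k).+1)%N by rewrite dvdn_exp.
      by rewrite /dvdn -(modn_dvdm _ pd) -e (modn_dvdm _ pd).
    by rewrite Euclid_dvdX // (negbTE pr).
  move=> /(padic_int_neq0 (p := p)); rewrite -ht t0 expr0n.
  by rewrite eqn0Ngt k_gt0 mulr0n.
exists (m * x)%:R, (m * y)%:R, t; split; first by case.
rewrite ht !rmorphN /= /u.
have natE (n : nat) : n%:Z%:~R = n%:R :> padic_int p by [].
rewrite !natE natrD !natrM !natrX !exprMn !mulNr mulrDr -opprD.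
by rewrite [a%:R * (_ * _)]mulrCA [b%:R * (_ * _)]mulrCA addNr.
Qed.

Lemma real_solvable_family (R : realType) (a b m : nat) : (0 < m)%N ->
  diag_solvable R k (- a%:Z) (- b%:Z) (m ^ k)%N%:Z.
Proof.
move=> m0; exists m%:R, 0, (a%:R `^ (k%:R^-1)); split.
  by case=> /eqP; rewrite pnatr_eq0 eqn0Ngt m0.
have -> : (a%:R `^ (k%:R^-1)) ^+ k = a%:R :> R.
  by rewrite -powR_mulrn ?powR_ge0 // -powRrM mulVf ?pnatr_eq0 -?lt0n // powRr1.
rewrite expr0n eqn0Ngt k_gt0 mulr0 addr0 rmorphN /=.
by rewrite -!pmulrn natrX; ring.
Qed.

(** [f p] stands for a colouring as in [power_class_coloring], chosen for all primes at once. *)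
Variable f : nat -> nat -> 'I_k.
Hypothesis fP : forall p, prime p -> forall (q : 'I_k -> nat) c,
    (forall i, ~~ (p %| q i)%N) -> (forall i, f p (q i) = c) ->
    exists r, ~~ (p %| r)%N /\ (\prod_i q i = r ^ k %[mod p])%N.

(** The threshold of [diag_curve_point_mod]. It is at least [k], so larger primes do not divide [k]
    and Hensel lifting starts from a congruence modulo [p]. *)
Definition small_bound := (16 * k ^ 4)%N.
(** A common multiple of the moduli p^(2 v_p(k) + 1) needed for Hensel lifting at the small primes;
    the exponent uses the crude bound v_p(k) <= k. *)
Definition small_modulus := (small_bound`! ^ (2 * k).+1)%N.

Lemma k_le_small_bound : (k <= small_bound)%N.
Proof.
rewrite /small_bound; apply: leq_trans (leq_pmull _ _); last by [].
by rewrite -{1}(expn1 k) leq_pexp2l.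
Qed.

Lemma logn_big p : prime p -> (small_bound < p)%N -> logn p k = 0%N.
Proof.
move=> p_pr pbig; apply/eqP; rewrite eqn0Ngt logn_gt0 mem_primes p_pr k_gt0 /=.
by apply/negP => /(dvdn_leq k_gt0); rewrite leqNgt (leq_ltn_trans k_le_small_bound).
Qed.

Lemma small_modulus_dvd p : prime p -> (p <= small_bound)%N ->
  (p ^ (2 * logn p k).+1 %| small_modulus)%N.
Proof.
move=> p_pr psmall; apply: (@dvdn_trans (p ^ (2 * k).+1)%N).
  apply: dvdn_exp2l; rewrite ltnS leq_mul2l /=.
  have : (logn p k < p ^ logn p k)%N by rewrite ltn_expl // prime_gt1.
  by move/ltnW/leq_trans; apply; rewrite dvdn_leq // pfactor_dvdnn.
by apply: dvdn_exp2r; rewrite dvdn_fact // prime_gt0.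
Qed.

Lemma prime_dvd_prod (p : nat) (v : 'I_k -> nat) : prime p ->
  (forall i, prime (v i)) -> (p %| \prod_i v i)%N -> exists i, p = v i.
Proof.
move=> p_pr v_pr; rewrite -(Fp_eq0_dvd _ p_pr) natr_prod => /eqP/eqP.
rewrite prodf_seq_eq0 => /hasP[i _]; rewrite Fp_eq0_dvd // dvdn_prime2 //.
by move=> /andP[_ /eqP->]; exists i.
Qed.

(** There are four cases. At a small prime the v_i are congruent, so their product is a k-th power
    and (x, y) = (1, 0) works. At p = v_i the colouring makes the product of the u_j a k-th power,
    and (0, 1) works; p = u_j is symmetric. Any other prime divides neither product, and
    [diag_curve_point_mod] applies. *)
Lemma everywhere_congruence (v u : 'I_k -> nat) (c : 'I_k * 'I_k) :
  (forall i, prime (v i) /\ (small_bound < v i)%N) ->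
  (forall j, prime (u j) /\ (small_bound < u j)%N) ->
  (forall i j, v i <> u j) ->
  (forall i i', v i = v i' %[mod small_modulus])%N ->
  (forall i j, (f (v i) (u j), f (u j) (v i)) = c) ->
  forall p, prime p -> exists x y r, ~~ (p %| r)%N /\
   ((\prod_i v i) * x ^ k + (\prod_j u j) * y ^ k = r ^ k
      %[mod p ^ (2 * logn p k).+1])%N.
Proof.
move=> vP uP vu vmod col p p_pr.
have v_pr i : prime (v i) by have [] := vP i.
have u_pr i : prime (u i) by have [] := uP i.
have [psmall|pbig] := leqP p small_bound.
  pose i0 := Ordinal k_gt0; exists 1%N, 0%N, (v i0); split.
    rewrite dvdn_prime2 //; apply/eqP => e.
    by have [_] := vP i0; rewrite -e ltnNge psmall.
  rewrite exp1n muln1 exp0n // muln0 addn0.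
  have d := small_modulus_dvd p_pr psmall.
  rewrite -[LHS](modn_dvdm _ d) -[RHS](modn_dvdm _ d); congr (_ %% _)%N.
  rewrite -[X in (_ = _ ^ X %[mod _])%N](card_ord k) -prod_nat_const.
  apply: (big_ind2 (fun m n => m = n %[mod small_modulus])%N) => // a b a' b' e e'.
  by rewrite -modnMm e e' modnMm.
rewrite logn_big // muln0 expn1.
have [[i ei]|hv] := pselect (exists i, p = v i).
  have [|j|r [pr er]] := fP p_pr (q := u) (c := c.1).
  - by move=> j; rewrite ei dvdn_prime2 //; apply/eqP/vu.
  - by rewrite -(col i j) ei.
  exists 0%N, 1%N, r; split=> //.
  by rewrite exp1n muln1 exp0n // muln0 add0n.
have [[j ej]|hu] := pselect (exists j, p = u j).
  have [|i|r [pr er]] := fP p_pr (q := v) (c := c.2).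
  - by move=> i; rewrite ej dvdn_prime2 //; apply/eqP => /esym/vu.
  - by rewrite -(col i j) ej.
  exists 1%N, 0%N, r; split=> //.
  by rewrite exp1n muln1 exp0n // muln0 addn0.
apply: diag_curve_point_mod => //; apply/negP => /(prime_dvd_prod p_pr).
  by move=> /(_ v_pr).
by move=> /(_ u_pr).
Qed.

Variable X : nat.

(** Bicliques together with m are mapped to triples. By unique factorisation a triple determines m
    and the sets of entries of the two tuples, so a fibre has at most k^k k^k elements. *)
Lemma M_loc_lower_bound (R : realType) (H : R) (P Q : {pred 'I_X.+1}) :
  (forall p, p \in P -> prime p /\ (small_bound < p)%N) ->
  (forall q, q \in Q -> prime q /\ (small_bound < q)%N) ->
  (forall p q, p \in P -> q \in Q -> p <> q) ->
  (forall p p', p \in P -> p' \in P -> (p = p' %[mod small_modulus])%N) ->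
  (0 < #|P|)%N -> (0 < #|Q|)%N -> (X ^ k)%:R <= H ->
  (#|P| ^ k * #|Q| ^ k * X <=
     (2 * (k * k) ^ k.+1) ^ k.+1 * (k ^ k * k ^ k * M_loc k H))%N.
Proof.
move=> hP hQ PQ Pmod P0 Q0 XH.
(* A colour records the power class in both directions, whence [k * k] colours. *)
pose color (p q : 'I_X.+1) := (f p q, f q p).
have [c] := @many_bicliques _ _ k color P Q P0 Q0.
rewrite card_prod card_ord => many.
apply: (@leq_trans ((2 * (k * k) ^ k.+1) ^ k.+1 * (#|bicliques (k := k) color P Q c| * X))%N).
  by rewrite mulnA leq_mul2r many orbT.
rewrite leq_mul2l; apply/orP; right.
pose B : {pred {ffun 'I_k -> 'I_X.+1} * {ffun 'I_k -> 'I_X.+1} * 'I_X} :=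
  [pred w | w.1 \in bicliques (k := k) color P Q c].
have -> : (#|bicliques (k := k) color P Q c| * X = #|B|)%N.
  rewrite -[X in (_ * X)%N]card_ord -cardX; apply: eq_card => -[w m].
  by rewrite !inE andbT.
pose pr (v : {ffun 'I_k -> 'I_X.+1}) := (\prod_i v i)%N.
(* The index in ['I_X] is shifted by one, so m runs over 1, ..., X and is never 0. *)
pose h (w : {ffun 'I_k -> 'I_X.+1} * {ffun 'I_k -> 'I_X.+1} * 'I_X) : int * int * int :=
  (- (pr w.1.1)%:Z, - (pr w.1.2)%:Z, (w.2.+1 ^ k)%N%:Z).
have BP w : w \in B -> [/\ forall i, w.1.1 i \in P, forall j, w.1.2 j \in Q &
    forall i j, color (w.1.1 i) (w.1.2 j) = c].
  rewrite inE => /andP[/andP[/forallP h1 /forallP h2] /forallP h3]; split=> //.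
  by move=> i j; apply/eqP; have /forallP := h3 i; apply.
have pr_gt0 (A : {pred 'I_X.+1}) (v : {ffun 'I_k -> 'I_X.+1}) : (forall p, p \in A -> prime p /\ (small_bound < p)%N) ->
    (forall i, v i \in A) -> (0 < pr v)%N.
  by move=> hA vA; rewrite prodn_gt0 // => i; rewrite prime_gt0 //; case: (hA _ (vA i)).
have pr_le v : (pr v <= X ^ k)%N.
  rewrite -[X in (_ <= _ ^ X)%N](card_ord k) -prod_nat_const.
  by apply: leq_prod => i _; rewrite -ltnS.
apply: (card_leq_fiber (h := h)) => [w wB|w wB].
  have [wP wQ wc] := BP w wB.
  rewrite in_fset_set; last first.
    by apply: sub_finite_set (finite_coef_box H) => t [].
  rewrite inE /=; split.
    rewrite /coef_box /=; split.
    - rewrite rmorphN normrN /= -pmulrn normr_nat ltr0n (pr_gt0 P) //=.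
      by apply: le_trans XH; rewrite ler_nat.
    - rewrite rmorphN normrN /= -pmulrn normr_nat ltr0n (pr_gt0 Q) //=.
      by apply: le_trans XH; rewrite ler_nat.
    - rewrite -pmulrn normr_nat ltr0n expn_gt0 /=.
      by apply: le_trans XH; rewrite ler_nat leq_expn2r.
  split; first exact: real_solvable_family.
  move=> p p_pr.
  have [|||||x [y [r [rp e]]]] := @everywhere_congruence
    (fun i => w.1.1 i) (fun i => w.1.2 i) c _ _ _ _ _ p p_pr.
  - by move=> i; apply: hP.
  - by move=> i; apply: hQ.
  - by move=> i j e; apply: (PQ _ _ (wP i) (wQ j)); apply: val_inj.
  - by move=> i i'; apply: Pmod.
  - by move=> i j; exact: wc.
  exact: padic_solvable_family e.
pose F1 : {pred {ffun 'I_k -> 'I_X.+1}} := ffun_on (mem (codom w.1.1)).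
pose F2 : {pred {ffun 'I_k -> 'I_X.+1}} := ffun_on (mem (codom w.1.2)).
have sub : {subset [pred y in B | h y == h w] <= [predX [predX F1 & F2] & pred1 w.2]}.
  move=> y /andP[yB /eqP[e1 e2 e3]].
  have [yP yQ _] := BP y yB; have [wP wQ _] := BP w wB.
  have codomP' (A : {pred 'I_X.+1}) (v v' : {ffun 'I_k -> 'I_X.+1}) :
      (forall p, p \in A -> prime p /\ (small_bound < p)%N) ->
      (forall i, v i \in A) -> (forall i, v' i \in A) -> pr v = pr v' ->
      v \in ffun_on (mem (codom v')).
    move=> hA vA v'A e; apply/ffun_onP => i.
    have [|||j ej] := @prime_dvd_prod (v i) (fun j => v' j).
    - by have [] := hA _ (vA i).
    - by move=> j; have [] := hA _ (v'A j).
    - by rewrite -[X in (_ %| X)%N]/(pr v') -e /pr (bigD1 i) //= dvdn_mulr.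
    by apply/codomP; exists j; apply: val_inj.
  rewrite !inE -andbA; apply/and3P; split.
  - by apply: (codomP' P) => //; case: (oppr_inj e1).
  - by apply: (codomP' Q) => //; case: (oppr_inj e2).
  - by apply/eqP/val_inj/eqP; move/eqP: e3; rewrite eqn_exp2r // eqSS.
apply: leq_trans (subset_leq_card (introT fintype.subsetP sub)) _.
rewrite !cardX card1 muln1 !card_ffun_on !card_ord leq_mul // leq_expn2r //;
  by rewrite (leq_trans (card_size _)) // size_codom card_ord.
Qed.
End LocalFamily.

(** * Growth of the prime count and of [M_loc] *)

Section Growth.
Variable R : realType.

Lemma ln_le_powR (d x : R) : 0 < d -> 0 < x -> ln x <= d^-1 * x `^ d.
Proof.
move=> d0 x0; rewrite ler_pdivlMl // -ln_powR ltW // ln_sublinear //.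
exact: powR_gt0.
Qed.

Lemma powR_eventually_ge (e B : R) : 0 < e ->
  exists X0 : nat, forall X : nat, (X0 <= X)%N -> B <= X%:R `^ e.
Proof.
move=> e0; exists (Num.truncn (`|B| `^ e^-1)).+1 => X hX.
apply: le_trans (ler_norm B) _.
have B0 : 0 <= `|B| by [].
have -> : `|B| = (`|B| `^ e^-1) `^ e by rewrite -powRrM mulVf ?powRr1 ?gt_eqF.
apply: ge0_ler_powR; rewrite ?nnegrE ?powR_ge0 //; first exact: ltW.
have /andP[_ /ltW/le_trans] := truncn_itv (powR_ge0 `|B| e^-1); apply.
by rewrite ler_nat.
Qed.

Definition prime_count n := #|[pred p : 'I_n.+1 | prime p]|.

Lemma leq_prime_count m n : (m <= n)%N -> (prime_count m <= prime_count n)%N.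
Proof.
move=> mn; have mn1 : (m.+1 <= n.+1)%N by [].
pose g (p : 'I_m.+1) : 'I_n.+1 := widen_ord mn1 p.
have gI : injective g by move=> p q /(congr1 val) /= /val_inj.
rewrite /prime_count -(fintype.card_image gI); apply: subset_leq_card.
by apply/fintype.subsetP => _ /fintype.imageP[p pp ->].
Qed.

(** With n = floor(X / 2), Chebyshev's bound gives n ln 2 <= prime_count(X) ln X. The logarithm is
    absorbed by ln X <= X^d / d, and the 3 in the constant comes from X <= 3 n. *)
Lemma prime_count_lower (d : R) : 0 < d ->
  exists2 c : R, 0 < c & forall X : nat, (2 <= X)%N ->
    c * X%:R `^ (1 - d) <= (prime_count X)%:R.
Proof.
move=> d0; exists (d * ln 2 / 3).
  by rewrite !mulr_gt0 ?invr_gt0 ?ln_gt0 //; lra.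
move=> X X2; set n := X./2.
have n0 : (0 < n)%N by rewrite half_gt0.
have nX : (n.*2 <= X)%N by rewrite -[leqRHS]odd_double_half leq_addl.
have Xn : X%:R <= 3 * n%:R :> R.
  by rewrite -natrM ler_nat /n; move: X2 (odd_double_half X); case: odd; lia.
have X0 : 0 < X%:R :> R by rewrite ltr0n; lia.
have : (2 ^ n <= X ^ prime_count X)%N.
  apply: leq_trans (exp2_leq_prime_count n0) _.
  apply: leq_trans (leq_expn2r _ nX) _.
  by rewrite leq_pexp2l //; [lia | exact: leq_prime_count].
move=> h0; have h : n%:R * ln 2 <= (prime_count X)%:R * ln X%:R :> R.
  rewrite !mulr_natl -!lnXn // ler_ln ?posrE ?exprn_gt0 // -!natrX ler_nat.
  exact: h0.
have lnX := ln_le_powR d0 X0.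
have l2 : 0 < ln 2 :> R by rewrite ln_gt0 //; lra.
have : n%:R * ln 2 <= (prime_count X)%:R * (d^-1 * X%:R `^ d).
  by apply: le_trans h _; rewrite ler_wpM2l.
rewrite mulrCA ler_pdivlMl // -ler_pdivrMr ?powR_gt0 // => h2.
apply: le_trans h2; rewrite powRB; last by rewrite (gt_eqF X0) implybT.
rewrite (powRr1 (ltW X0)) mulrA ler_wpM2r ?invr_ge0 ?powR_ge0 //.
have -> : d * ln 2 / 3 * X%:R = d * ln 2 * (X%:R / 3) by ring.
have -> : d * (n%:R * ln 2) = d * ln 2 * n%:R :> R by ring.
rewrite ler_wpM2l ?mulr_ge0 ?(ltW d0) ?(ltW l2) //.
by rewrite ler_pdivrMr // mulrC.
Qed.

End Growth.

(** Among the primes above [small_bound k], the most popular residue class modulo [small_modulus k]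
    is cut into two disjoint halves of size at least [s]; the class itself has at most 2 s + 1
    elements. *)
Lemma two_prime_sets k X : (0 < k)%N -> exists (P Q : {pred 'I_X.+1}) (s : nat),
  [/\ [/\ forall p, p \in P -> prime p /\ (small_bound k < p)%N,
      forall q, q \in Q -> prime q /\ (small_bound k < q)%N,
      forall p q, p \in P -> q \in Q -> p <> q &
      forall p p', p \in P -> p' \in P -> (p = p' %[mod small_modulus k])%N],
    (s <= #|P|)%N, (s <= #|Q|)%N &
    (prime_count X <= (small_bound k).+1 + small_modulus k * s.*2.+1)%N].
Proof.
move=> k0; pose S : {pred 'I_X.+1} := [pred p : 'I_X.+1 | prime p && (small_bound k < p)%N].
have M0 : (0 < small_modulus k)%N by rewrite expn_gt0 fact_gt0.
have cS : (prime_count X <= (small_bound k).+1 + #|S|)%N.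
  rewrite /prime_count -(cardID [pred p : 'I_X.+1 | p <= small_bound k]%N) leq_add //.
    apply: leq_trans (card_ord_lt (small_bound k).+1 X.+1); apply: subset_leq_card.
    by apply/fintype.subsetP => p; rewrite !inE => /andP[_].
  apply: subset_leq_card; apply/fintype.subsetP => p.
  by rewrite !inE -ltnNge andbC.
have [S0|S_gt0] := posnP #|S|.
  exists (fun=> false), (fun=> false), 0%N; split=> //; apply: leq_trans cS _.
  by rewrite S0 leq_add2l.
have [c] := popular_value (fun p : 'I_X.+1 => Ordinal (ltn_pmod p M0)) S_gt0.
rewrite card_ord; set A := [pred p in S | _] => cA.
pose s := (#|A|)./2; exists (fun p => p \in take s (enum A)), (fun p => p \in drop s (enum A)), s.
have uA := enum_uniq A; rewrite -(cat_take_drop s (enum A)) cat_uniq in uA.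
case/and3P: uA => u1 u2 u3.
have inA (p : 'I_X.+1) : p \in enum A -> [/\ prime p, (small_bound k < p)%N &
    (p %% small_modulus k = c)%N].
  by rewrite mem_enum !inE => /andP[/andP[-> ->] /eqP<-].
split; first split.
- by move=> p /mem_take/inA[].
- by move=> p /mem_drop/inA[].
- by move=> p q pP qQ e; move/hasPn: u2 => /(_ _ qQ); rewrite -e pP.
- by move=> p q /mem_take/inA[_ _ ->] /mem_take/inA[_ _ ->].
- rewrite (card_uniqP u1) size_take -cardE; case: ltnP => // _.
  by rewrite /s -divn2 leq_div.
- rewrite (card_uniqP u3) size_drop -cardE /s.
  by move: (#|A|) => a; clear; rewrite -{2}(odd_double_half a); lia.
apply: leq_trans cS _; rewrite leq_add2l (leq_trans cA) // leq_mul2l.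
by apply/orP; right; rewrite /s; move: (#|A|) => a; clear; rewrite -{1}(odd_double_half a); case: odd; lia.
Qed.

Lemma M_loc_growth (R : realType) k : (0 < k)%N ->
  exists2 c : R, 0 < c & exists X0 : nat, forall X : nat, (X0 <= X)%N ->
    forall H : R, (X ^ k)%:R <= H ->
    c * X%:R `^ (2 * k%:R + 2^-1) <= (M_loc k H)%:R.
Proof.
move=> k0.
have [f fP] : exists f : nat -> nat -> 'I_k, forall p, prime p ->
    forall (q : 'I_k -> nat) c,
    (forall i, ~~ (p %| q i)%N) -> (forall i, f p (q i) = c) ->
    exists r, ~~ (p %| r)%N /\ (\prod_i q i = r ^ k %[mod p])%N.
  have /choice[f fP] : forall p, exists g : nat -> 'I_k, prime p ->
    forall (q : 'I_k -> nat) c,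
    (forall i, ~~ (p %| q i)%N) -> (forall i, g (q i) = c) ->
    exists r, ~~ (p %| r)%N /\ (\prod_i q i = r ^ k %[mod p])%N.
    move=> p; have [p_pr|np] := boolP (prime p); last by exists (fun=> Ordinal k0).
    by have [g gP] := power_class_coloring k0 p_pr; exists g.
  by exists f.
have kR : 0 < k%:R :> R by rewrite ltr0n.
(* This choice gives 2k (1 - d) + 1 = 2k + 1/2, the exponent of X in the claim. *)
pose d : R := (4 * k%:R)^-1.
have d0 : 0 < d by rewrite invr_gt0 mulr_gt0.
have k1 : 1 <= k%:R :> R by rewrite ler1n.
have d1 : d < 1 by rewrite invf_lt1 //; lra.
have [c1 c10 hc1] := prime_count_lower d0.
pose M : R := (small_modulus k)%:R; pose b : R := (small_bound k).+1%:R.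
have M0 : 0 < M by rewrite ltr0n expn_gt0 fact_gt0.
pose D : nat := ((2 * (k * k) ^ k.+1) ^ k.+1 * (k ^ k * k ^ k))%N.
have D0 : 0 < D%:R :> R by rewrite ltr0n !muln_gt0 ?expn_gt0 ?muln_gt0 ?expn_gt0 ?muln_gt0 k0.
pose c2 : R := c1 / (4 * M).
have c20 : 0 < c2 by rewrite divr_gt0 // mulr_gt0.
exists (c2 ^+ (2 * k) / D%:R); first by rewrite divr_gt0 // exprn_gt0.
(* From [X1] on, the additive terms b + M are at most half of c1 X^(1-d), which leaves s >= c1
   X^(1-d) / (4 M). *)
have [|X1 hX1] := powR_eventually_ge (e := 1 - d) (2 * (b + M) / c1); first by rewrite subr_gt0.
exists (maxn 2 X1) => X; rewrite geq_max => /andP[X2 XX1] H XH.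
have X0 : 0 < X%:R :> R by rewrite ltr0n; lia.
have [P [Q [s [[hP hQ PQ Pmod] sP sQ count]]]] := two_prime_sets X k0.
have s_big : c2 * X%:R `^ (1 - d) <= s%:R.
  have := hc1 _ X2; have := hX1 _ XX1; rewrite ler_pdivrMr // [_ * c1]mulrC.
  have h1 : (prime_count X)%:R <= b + M * (s%:R * 2 + 1).
    have -> : s%:R * 2 + 1 = s.*2.+1%:R :> R by rewrite -[s.*2.+1%:R]natr1 -muln2 natrM.
    by rewrite -natrM -natrD ler_nat.
  set y := c1 * _ => h2 h3.
  have -> : c2 * X%:R `^ (1 - d) = y / (4 * M) by rewrite /c2 /y mulrAC.
  rewrite ler_pdivrMr ?mulr_gt0 //; move: h1 h2 h3; clear; lra.
have s0 : (0 < s)%N.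
  by rewrite -(ltr0n R); apply: lt_le_trans s_big; rewrite mulr_gt0 ?powR_gt0.
have := M_loc_lower_bound k0 fP hP hQ PQ Pmod (leq_trans s0 sP) (leq_trans s0 sQ) XH.
rewrite mulnA -/D => main.
have : (s ^ (2 * k) * X <= D * M_loc k H)%N.
  by apply: leq_trans main; rewrite leq_mul2r mul2n -addnn expnD leq_mul ?orbT ?leq_expn2r.
move=> h0; have h : X%:R * s%:R ^+ (2 * k) <= (M_loc k H)%:R * D%:R :> R.
  by rewrite -natrX -!natrM ler_nat [leqRHS]mulnC mulnC.
rewrite mulrAC ler_pdivrMr //; apply: le_trans h.
have -> : X%:R `^ (2 * k%:R + 2^-1) = X%:R * (X%:R `^ (1 - d)) ^+ (2 * k).
  rewrite -powR_mulrn ?powR_ge0 // -powRrM -{2}(powRr1 (ltW X0)) -powRD; last first.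
    by rewrite (gt_eqF X0) implybT.
  congr (_ `^ _); rewrite natrM /d; field.
  by rewrite gt_eqF.
rewrite mulrCA -exprMn ler_wpM2l ?ler0n // lerXn2r // nnegrE ?ler0n //.
by rewrite mulr_ge0 ?powR_ge0 ?ltW.
Qed.

(** * Counting soluble triples under the abc-conjecture *)

Section RadicalBound.
Local Open Scope nat_scope.

Lemma prod_primes_gt0 s : all prime s -> 0 < \prod_(q <- s) q.
Proof.
elim: s => [|q s IH] /=; first by rewrite big_nil.
by case/andP => q_pr /IH s0; rewrite big_cons muln_gt0 prime_gt0.
Qed.

Lemma logn_prod_primes p s : all prime s -> uniq s ->
  logn p (\prod_(q <- s) q) = (p \in s).
Proof.
elim: s => [|q s IH] /=; first by rewrite big_nil logn1.
case/andP => q_pr s_pr /andP[qs us]; rewrite big_cons.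
rewrite lognM ?(prime_gt0 q_pr) ?prod_primes_gt0 // (IH s_pr us) in_cons logn_prime //.
by case: eqVneq => [->|//]; rewrite (negbTE qs).
Qed.

Lemma all_prime_primes n : all prime (primes n).
Proof. by apply/allP => p; rewrite mem_primes => /and3P[]. Qed.

Lemma radical_gt0 n : 0 < radical n.
Proof. exact/prod_primes_gt0/all_prime_primes. Qed.

Lemma logn_radical p n : 0 < n -> prime p -> logn p (radical n) = (p %| n).
Proof.
move=> n0 p_pr; rewrite logn_prod_primes ?primes_uniq ?all_prime_primes //.
by rewrite mem_primes p_pr n0.
Qed.

(* Valuation by valuation: a prime dividing the gcd [d] must divide a coefficient
   at one index and a variable at another, and the variable pays for the extra
   factor [p] coming from the radical. *)
Lemma gcd_radical_bound k (a b c x y z d A B C : nat) :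
  0 < a -> 0 < b -> 0 < c -> 0 < x -> 0 < y -> 0 < z ->
  gcdn (gcdn a b) c = 1 -> gcdn (gcdn x y) z = 1 ->
  a * x ^ k = d * A -> b * y ^ k = d * B -> c * z ^ k = d * C ->
  d * radical (A * B * C) <= a * b * c * (x * y * z).
Proof.
move=> a0 b0 c0 x0 y0 z0 gabc gxyz eA eB eC.
have xk0 : 0 < x ^ k by rewrite expn_gt0 x0.
have yk0 : 0 < y ^ k by rewrite expn_gt0 y0.
have zk0 : 0 < z ^ k by rewrite expn_gt0 z0.
have dA : 0 < d * A by rewrite -eA muln_gt0 a0.
have dB : 0 < d * B by rewrite -eB muln_gt0 b0.
have dC : 0 < d * C by rewrite -eC muln_gt0 c0.
move: dA dB dC; rewrite !muln_gt0 => /andP[d0 A0] /andP[_ B0] /andP[_ C0].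
have ABC0 : 0 < A * B * C by rewrite !muln_gt0 A0 B0.
have rhs0 : 0 < a * b * c * (x * y * z) by rewrite !muln_gt0 a0 b0 c0 x0 y0.
have lhs0 : 0 < d * radical (A * B * C) by rewrite muln_gt0 d0 radical_gt0.
apply: dvdn_leq => //; apply/(dvdn_partP _ lhs0) => p.
rewrite mem_primes => /and3P[p_pr _ _]; rewrite p_part pfactor_dvdn //.
rewrite !lognM ?muln_gt0 ?radical_gt0 ?d0 ?a0 ?b0 ?c0 ?x0 ?y0 ?z0 //.
rewrite logn_radical //.
have hA := congr1 (logn p) eA; have hB := congr1 (logn p) eB.
have hC := congr1 (logn p) eC.
rewrite !lognM // !lognX in hA hB hC.
have dvd0 n : 0 < n -> (p %| n) = (0 < logn p n).
  by move=> n0; rewrite -[p in LHS]expn1 pfactor_dvdn.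
have : (p %| A * B * C) = (0 < logn p A + logn p B + logn p C).
  by rewrite dvd0 // !lognM // muln_gt0 A0.
move=> ->.
have hcoef : [|| logn p a == 0, logn p b == 0 | logn p c == 0].
  have : ~~ (p %| gcdn (gcdn a b) c) by rewrite gabc Euclid_dvd1.
  by rewrite !dvdn_gcd !dvd0 // !negb_and -!eqn0Ngt orbA.
have hvar : [|| logn p x == 0, logn p y == 0 | logn p z == 0].
  have : ~~ (p %| gcdn (gcdn x y) z) by rewrite gxyz Euclid_dvd1.
  by rewrite !dvdn_gcd !dvd0 // !negb_and -!eqn0Ngt orbA.
move: hA hB hC hcoef hvar.
move: (logn p a) (logn p b) (logn p c) (logn p x) (logn p y) (logn p z).
move: (logn p d) (logn p A) (logn p B) (logn p C).
clear => d A B C a b c x y z hA hB hC.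
(* Once it is known which variables are prime to [p], the products with [k] are zero or can be
   treated as unknowns, and the rest is linear. *)
case: (posnP x) (posnP y) (posnP z) hA hB hC => [->|x0] [->|y0] [->|z0];
  rewrite ?muln0 => hA hB hC; lia.
Qed.

End RadicalBound.

(** * Solutions in natural numbers with separate signs *)

Section SignedSolutions.
Local Open Scope nat_scope.
Variable k : nat.

(** [s] holds the signs of the three terms, so that coefficients and variables are natural numbers
    and the parity of [k] does not matter. *)
Definition signed_sol (s : bool * bool * bool) (a b c x y z : nat) : bool :=
  ((-1) ^+ s.1.1 * (a * x ^ k)%:Z + (-1) ^+ s.1.2 * (b * y ^ k)%:Z
     + (-1) ^+ s.2 * (c * z ^ k)%:Z == 0)%R.

Lemma dvdz_signr (s : bool) (d m : int) :
  (d %| ((-1) ^+ s * m)%R)%Z = (d %| m)%Z.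
Proof. by case: s; rewrite ?expr1 ?expr0 ?mulN1r ?mul1r ?rpredN. Qed.

Lemma signed_sol_scale s d a b c x y z : 0 < d ->
  signed_sol s (d * a) (d * b) (d * c) x y z = signed_sol s a b c x y z.
Proof.
move=> d0; rewrite /signed_sol -!mulnA !PoszM.
have dz : d%:Z != 0%R by rewrite eqz_nat -lt0n.
rewrite -[RHS](inj_eq (mulfI dz)) mulr0;
  congr (_ == _); ring.
Qed.

Lemma signed_sol_dvd s a b c x y z d : signed_sol s a b c x y z ->
  d %| b * y ^ k -> d %| c * z ^ k -> d %| a * x ^ k.
Proof.
move=> /eqP e db dc; have : (d %| ((-1) ^+ s.1.1 * (a * x ^ k)%:Z)%R)%Z.
  have -> : ((-1) ^+ s.1.1 * (a * x ^ k)%:Z = - ((-1) ^+ s.1.2 * (b * y ^ k)%:Z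
     + (-1) ^+ s.2 * (c * z ^ k)%:Z))%R by apply/eqP; rewrite -addr_eq0 addrA e.
  by rewrite rpredN rpredD // dvdz_signr.
by rewrite dvdz_signr.
Qed.

Lemma signed_sol_diff s a b c b' c' x y z :
  signed_sol s a b c x y z -> signed_sol s a b' c' x y z ->
  (((-1) ^+ s.1.2 * (b%:Z - b'%:Z) * (y ^ k)%:Z =
    - ((-1) ^+ s.2 * (c%:Z - c'%:Z) * (z ^ k)%:Z))%R).
Proof.
rewrite /signed_sol !PoszM => /eqP e1 /eqP e2.
by apply/eqP; rewrite -subr_eq0 opprK; apply/eqP; rewrite -[RHS](subrr 0%R)
  -{1}e1 -e2; ring.
Qed.

(** Let h = gcd(y, z) and w = (z / h)^k. Since h is prime to x, h^k divides a; for given a the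
    residue of b modulo w is fixed; and a, b determine c. This leaves at most (N / h^k + 1)(N / w +
    1) triples, while z^k = h^k w. *)
Lemma card_signed_sol N s x y z : 0 < z -> gcdn x (gcdn y z) = 1 ->
  z ^ k * #|[pred t : 'I_N.+1 * 'I_N.+1 * 'I_N.+1 |
     signed_sol s t.1.1 t.1.2 t.2 x y z]| <= N ^ 2 + 3 * (N * z ^ k) + z ^ k.
Proof.
move=> z0 cop; set S := [pred t | _].
set h := gcdn y z in cop; have h0 : 0 < h by rewrite gcdn_gt0 z0 orbT.
have hk0 : 0 < h ^ k by rewrite expn_gt0 h0.
have hz : h %| z := dvdn_gcdr y z; have hy : h %| y := dvdn_gcdl y z.
pose w := (z %/ h) ^ k; have ew : z ^ k = h ^ k * w by rewrite -expnMn mulnC divnK.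
have w0 : 0 < w by rewrite expn_gt0 divn_gt0 // dvdn_leq.
pose f (t : 'I_N.+1 * 'I_N.+1 * 'I_N.+1) : 'I_(N %/ h ^ k).+1 * 'I_(N %/ w).+1 :=
  (inord (t.1.1 %/ h ^ k), inord (t.1.2 %/ w)).
have fI : {in S &, injective f}.
  move=> [[a b] c] [[a' b'] c']; rewrite !inE /= => e1 e2.
  have ha (a0 b0 c0 : nat) : signed_sol s a0 b0 c0 x y z -> h ^ k %| a0.
    move=> e; have : h ^ k %| a0 * x ^ k.
      by apply: signed_sol_dvd e _ _; apply: dvdn_mull; apply: dvdn_exp2r.
    by rewrite Gauss_dvdl // coprimeXl // coprimeXr // coprime_sym /coprime cop.
  case=> /(congr1 (@nat_of_ord _)) + /(congr1 (@nat_of_ord _)).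
  have div_lt (t : 'I_N.+1) d : t %/ d < (N %/ d).+1.
    by rewrite ltnS leq_div2r // -ltnS.
  rewrite !inordK ?div_lt // => ea eb.
  have aa : a = a'.
    by apply: val_inj; rewrite /= -(divnK (ha _ _ _ e1)) -(divnK (ha _ _ _ e2)) ea.
  rewrite -aa in e2; have ed := signed_sol_diff e1 e2.
  have bb : b = b'.
    apply: val_inj; rewrite /= (divn_eq b w) (divn_eq b' w) eb; congr (_ + _).
    suff : (w %| (b%:Z - b'%:Z)%R)%Z.
      by rewrite -eqz_mod_dvd !modz_nat => /eqP[].
    have : ((z ^ k)%N %| ((b%:Z - b'%:Z) * (y ^ k)%:Z)%R)%Z.
      by rewrite -(dvdz_signr s.1.2) mulrA ed rpredN dvdz_mull.
    rewrite !dvdzE abszM /= ew -(divnK hy) expnMn mulnA [_ * h ^ k]mulnC dvdn_pmul2l //.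
    rewrite Gauss_dvdl // coprimeXl // coprimeXr //.
    by rewrite coprime_sym /coprime -(eqn_pmul2r h0) muln_gcdl !divnK // mul1n eqxx.
  rewrite aa bb; congr (_, _); apply: val_inj.
  move: ed; rewrite bb subrr mulr0 mul0r => /esym/eqP.
  rewrite oppr_eq0 !mulf_eq0 signr_eq0 /= orbC -[_ == _ :> int]/(_ ^ _ == 0).
  by rewrite expn_eq0 eqn0Ngt z0 /= subr_eq0 => /eqP[].
have : #|S| <= (N %/ h ^ k).+1 * (N %/ w).+1.
  by rewrite -(card_in_image fI) (leq_trans (max_card _)) // card_prod !card_ord.
move=> le; apply: leq_trans (leq_mul (leqnn _) le) _; rewrite ew.
have := leq_trunc_div N (h ^ k); have := leq_trunc_div N w.
move: (N %/ w) (N %/ h ^ k) => u v.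
have : h ^ k <= h ^ k * w by rewrite leq_pmulr.
have : w <= h ^ k * w by rewrite leq_pmull.
move: (h ^ k) (w) => d e; clear => eP dP h1 h2.
have h3 : (v * d + d) * (u * e + e) <= (N + d) * (N + e).
  by apply: leq_mul; rewrite leq_add2r.
have h4 : N * d <= N * (d * e) by rewrite leq_mul2l dP orbT.
have h5 : N * e <= N * (d * e) by rewrite leq_mul2l eP orbT.
have -> : d * e * (v.+1 * u.+1) = (v * d + d) * (u * e + e) by ring.
apply: leq_trans h3 _; rewrite mulnDl !mulnDr -mulnn.
by move: (N * e) (N * d) (d * N) (mulnC d N) (N * (d * e)) (d * e) h4 h5; lia.
Qed.

(** Both coefficient vectors are orthogonal to the vector of signed k-th powers, so z^k divides the
    products of D = a b' - a' b with x^k, y^k and z^k, hence D itself. As |D| <= N^2 < z^k, D = 0.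
    The vectors are thus proportional, and equal gcds make them equal. *)
Lemma signed_sol_unique N s a b c a' b' c' x y z :
  0 < b -> 0 < b' -> 0 < z -> a <= N -> b <= N -> a' <= N -> b' <= N ->
  gcdn (gcdn x y) z = 1 -> N ^ 2 < z ^ k ->
  gcdn (gcdn a b) c = gcdn (gcdn a' b') c' -> 0 < gcdn (gcdn a b) c ->
  signed_sol s a b c x y z -> signed_sol s a' b' c' x y z ->
  [/\ a = a', b = b' & c = c'].
Proof.
move=> b0 b'0 z0 aN bN a'N b'N gxyz big geq g0 e1 e2.
pose X : int := ((-1) ^+ s.1.1 * (x ^ k)%:Z)%R.
pose Y : int := ((-1) ^+ s.1.2 * (y ^ k)%:Z)%R.
pose Z : int := ((-1) ^+ s.2 * (z ^ k)%:Z)%R.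
have Z0 : Z != 0%R.
  by rewrite mulf_neq0 ?signr_eq0 // -[_ == _ :> int]/(_ ^ _ == 0) expn_eq0 eqn0Ngt z0.
have {}e1 : (a%:Z * X + b%:Z * Y + c%:Z * Z = 0)%R.
  by rewrite -(eqP e1) !PoszM /X /Y /Z; ring.
have {}e2 : (a'%:Z * X + b'%:Z * Y + c'%:Z * Z = 0)%R.
  by rewrite -(eqP e2) !PoszM /X /Y /Z; ring.
pose D : int := (a%:Z * b'%:Z - a'%:Z * b%:Z)%R.
have DX : (D * X = (c'%:Z * b%:Z - c%:Z * b'%:Z) * Z)%R.
  apply/eqP; rewrite -subr_eq0; apply/eqP.
  rewrite -[RHS](subrr 0%R) -[X in _ = (X - _)%R](mulr0 b'%:Z) -{1}e1.
  by rewrite -[X in _ = (_ - X)%R](mulr0 b%:Z) -e2 /D; ring.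
have DY : (D * Y = (c%:Z * a'%:Z - c'%:Z * a%:Z) * Z)%R.
  apply/eqP; rewrite -subr_eq0; apply/eqP.
  rewrite -[RHS](subrr 0%R) -[X in _ = (X - _)%R](mulr0 a%:Z) -{1}e2.
  by rewrite -[X in _ = (_ - X)%R](mulr0 a'%:Z) -e1 /D; ring.
have zD : z ^ k %| absz D.
  have h1 : z ^ k %| absz D * x ^ k.
    by have := congr1 absz DX; rewrite /X /Z !abszM !absz_sign !mul1n /= => ->; apply: dvdn_mull.
  have h2 : z ^ k %| absz D * y ^ k.
    by have := congr1 absz DY; rewrite /Y /Z !abszM !absz_sign !mul1n /= => ->; apply: dvdn_mull.
  have g1 : gcdn (gcdn (x ^ k) (y ^ k)) (z ^ k) = 1.
    apply/eqP; rewrite eqn_leq gcdn_gt0 expn_gt0 z0 !orbT andbT leqNgt.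
    apply/negP => /pdivP[p p_pr]; rewrite !dvdn_gcd => /andP[/andP[px py] pz].
    have : p %| gcdn (gcdn x y) z.
      by rewrite !dvdn_gcd !(Euclid_dvdX _ _ p_pr) in px py pz *; case/andP: px => ->;
        case/andP: py => ->; case/andP: pz => ->.
    by rewrite gxyz Euclid_dvd1.
  by rewrite -[absz D]muln1 -g1 !muln_gcdr !dvdn_gcd h1 h2 dvdn_mull.
have D0 : D = 0%R.
  apply/eqP; rewrite -absz_eq0 eqn0Ngt; apply/negP => /dvdn_leq/(_ zD).
  rewrite leqNgt; apply/negP; rewrite negbK; apply: leq_ltn_trans big.
  have : a * b' <= N ^ 2 by rewrite -mulnn leq_mul.
  have : a' * b <= N ^ 2 by rewrite -mulnn leq_mul.
  by rewrite /D -!PoszM; move: (a * b') (a' * b) (N ^ 2); clear; lia.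
have ab : a * b' = a' * b.
  by apply/eqP; rewrite -eqz_nat !PoszM -subr_eq0; apply/eqP.
have cb : c' * b = c * b'.
  move: DX; rewrite D0 mul0r => /esym/eqP; rewrite mulf_eq0 (negbTE Z0) orbF.
  by rewrite subr_eq0 => /eqP; rewrite -!PoszM => -[].
(* With g the common gcd, g b' = gcd(a b', b b', c b') = gcd(a' b, b' b, c' b) = g b. *)
have bb : b' = b.
  apply/eqP; rewrite -(eqn_pmul2l g0) {2}geq !muln_gcdl ab [b * b']mulnC.
  by rewrite -cb [b' * b]mulnC.
split=> //; last by apply/eqP; rewrite -(eqn_pmul2r b0) cb bb.
by apply/eqP; rewrite -(eqn_pmul2r b0) -ab bb.
Qed.

End SignedSolutions.

(** * Size of solutions under the abc-conjecture *)

Section AbcConsequence.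
Variables (R : realType) (k : nat).
Hypotheses (k6 : (6 <= k)%N) (habc : abc_conjecture R).

(** The three terms divided by their gcd d form a coprime abc-triple of radical r. Since d <=
    d^(1+e), multiplying back bounds each term by C (d r)^(1+e), and [gcd_radical_bound] controls d
    r. *)
Lemma abc_signed_sol (e : R) : 0 < e -> exists2 C : R, 1 <= C &
  forall s (a b c x y z : nat),
  [&& 0 < a, 0 < b, 0 < c, 0 < x, 0 < y & 0 < z]%N ->
  gcdn (gcdn a b) c = 1%N -> gcdn (gcdn x y) z = 1%N ->
  signed_sol k s a b c x y z ->
  [/\ (a * x ^ k)%:R <= C * (a * b * c * (x * y * z))%:R `^ (1 + e),
      (b * y ^ k)%:R <= C * (a * b * c * (x * y * z))%:R `^ (1 + e) &
      (c * z ^ k)%:R <= C * (a * b * c * (x * y * z))%:R `^ (1 + e)].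
Proof.
move=> e0; have [C0 hC0] := habc e0; exists (Num.max 1 C0).
  by rewrite le_max lexx.
move=> s a b c x y z /and5P[a0 b0 c0 x0 /andP[y0 z0]] gabc gxyz sol.
pose A := (a * x ^ k)%N; pose B := (b * y ^ k)%N; pose D := (c * z ^ k)%N.
pose d := gcdn (gcdn A B) D.
have A0 : (0 < A)%N by rewrite muln_gt0 a0 expn_gt0 x0.
have B0 : (0 < B)%N by rewrite muln_gt0 b0 expn_gt0 y0.
have D0 : (0 < D)%N by rewrite muln_gt0 c0 expn_gt0 z0.
have d0 : (0 < d)%N by rewrite !gcdn_gt0 A0.
have dA : (d %| A)%N by rewrite (dvdn_trans (dvdn_gcdl _ _)) ?dvdn_gcdl.
have dB : (d %| B)%N by rewrite (dvdn_trans (dvdn_gcdl _ _)) ?dvdn_gcdr.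
have dD : (d %| D)%N by rewrite dvdn_gcdr.
pose A' := (A %/ d)%N; pose B' := (B %/ d)%N; pose D' := (D %/ d)%N.
have eA : A = (d * A')%N by rewrite mulnC divnK.
have eB : B = (d * B')%N by rewrite mulnC divnK.
have eD : D = (d * D')%N by rewrite mulnC divnK.
have A'0 : (0 < A')%N by rewrite divn_gt0 // dvdn_leq.
have B'0 : (0 < B')%N by rewrite divn_gt0 // dvdn_leq.
have D'0 : (0 < D')%N by rewrite divn_gt0 // dvdn_leq.
have dr := gcd_radical_bound a0 b0 c0 x0 y0 z0 gabc gxyz eA eB eD.
pose al : int := (-1) ^+ s.1.1 * A'%:Z; pose be : int := (-1) ^+ s.1.2 * B'%:Z.
pose ga : int := - ((-1) ^+ s.2 * D'%:Z).
have sum0 : al + be = ga.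
  apply/eqP; rewrite -subr_eq0 /ga opprK.
  have dz : d%:Z != 0 by rewrite eqz_nat -lt0n.
  rewrite -(inj_eq (mulfI dz)) mulr0 -(eqP sol) -/A -/B -/D eA eB eD !PoszM.
  by apply/eqP; rewrite /al /be; ring.
have abs_al : `|al|%N = A' by rewrite abszM absz_sign mul1n.
have abs_be : `|be|%N = B' by rewrite abszM absz_sign mul1n.
have abs_ga : `|ga|%N = D' by rewrite abszN abszM absz_sign mul1n.
have gcd1 : gcdz (gcdz al be) ga = 1.
  rewrite /gcdz /= abs_al abs_be abs_ga; congr Posz.
  apply/eqP; rewrite -(eqn_pmul2l d0) muln1 !muln_gcdr -eA -eB -eD.
  exact: eqxx.
have abs_prod : absz (al * be * ga) = (A' * B' * D')%N.
  by rewrite 2!abszM abs_al abs_be abs_ga.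
have nz : al * be * ga != 0.
  by rewrite -absz_eq0 abs_prod -lt0n !muln_gt0 A'0 B'0 D'0.
have := hC0 _ _ _ sum0 gcd1 nz.
rewrite abs_prod -!abszE abs_al abs_be abs_ga.
set r := radical _ in dr *; set W := (a * b * c * (x * y * z))%N in dr *.
have r0 : (0 < r)%N := radical_gt0 _.
set Mx := Num.max _ _ => hM.
have key n n' : n = (d * n')%N -> n'%:Z <= Mx ->
    n%:R <= Num.max 1 C0 * W%:R `^ (1 + e).
  move=> -> n'M; have {n'M}n'r : n'%:R <= Num.max 1 C0 * r%:R `^ (1 + e) :> R.
    have : n'%:R <= Mx%:~R :> R by rewrite -[n'%:R]/(n'%:Z%:~R) ler_int.
    move=> /le_trans/(_ hM)/le_trans; apply; rewrite ler_wpM2r ?powR_ge0 //.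
    by rewrite le_max lexx orbT.
  have e1 : 0 <= 1 + e by rewrite addr_ge0 // ltW.
  rewrite natrM; apply: (@le_trans _ _ (d%:R `^ (1 + e) * (Num.max 1 C0 * r%:R `^ (1 + e)))).
    apply: ler_pM => //; apply: le1r_powR; first by rewrite ler1n.
    by rewrite lerDl ltW.
  rewrite mulrCA -powRM // ler_wpM2l //; first by rewrite le_max ler01.
  by apply: ge0_ler_powR; rewrite ?nnegrE // -natrM ler_nat.
by split; [apply: key eA _|apply: key eB _|apply: key eD _]; rewrite /Mx !le_max lexx ?orbT.
Qed.

(** Put u = xyz and v = abc. Multiplying the three bounds gives v u^6 <= v u^k <= C^3 (v u)^(3+3e1),
    that is u^(3-3e1) <= C^3 v^(2+3e1), where v <= T^3. *)
Lemma abc_xyz_bound (e : R) : 0 < e -> exists2 C : R, 1 <= C &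
  forall s (a b c x y z : nat) (T : R),
  [&& 0 < a, 0 < b, 0 < c, 0 < x, 0 < y & 0 < z]%N ->
  gcdn (gcdn a b) c = 1%N -> gcdn (gcdn x y) z = 1%N ->
  signed_sol k s a b c x y z -> a%:R <= T -> b%:R <= T -> c%:R <= T ->
  (x * y * z)%:R <= C * T `^ (2 + e).
Proof.
(* The final exponent requires 3 (2 + 3 e1) <= (2 + e)(3 - 3 e1), i.e. 15 e1 + 3 e e1 <= 3 e; each
   bound on [e1] makes one of the two summands at most 3e / 2. *)
move=> e0; pose e1 : R := Num.min (2^-1) (e / 10).
have e10 : 0 < e1 by rewrite lt_min invr_gt0 ltr0n divr_gt0.
have e1h : e1 <= 2^-1 by rewrite ge_min lexx.
have e1e : e1 <= e / 10 by rewrite ge_min lexx orbT.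
have [C C1 hC] := abc_signed_sol e10.
pose q : R := (3 - 3 * e1)^-1.
have den : 0 < 3 - 3 * e1 by lra.
have q0 : 0 < q by rewrite invr_gt0.
exists ((C ^+ 3) `^ q).
  rewrite -(powRr0 (C ^+ 3)); apply: ler_powR; last exact: ltW.
  by rewrite exprn_ege1.
move=> s a b c x y z T pos gabc gxyz sol aT bT cT.
have [hA hB hD] := hC _ _ _ _ _ _ _ pos gabc gxyz sol.
case/and5P: pos => a0 b0 c0 x0 /andP[y0 z0].
pose u : R := (x * y * z)%:R; pose v : R := (a * b * c)%:R.
have u1 : 1 <= u by rewrite ler1n !muln_gt0 x0 y0 z0.
have v1 : 1 <= v by rewrite ler1n !muln_gt0 a0 b0 c0.
have T1 : 1 <= T by apply: le_trans aT; rewrite ler1n.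
have [u0 v0] : 0 < u /\ 0 < v by split; apply: lt_le_trans ltr01 _.
have T0 : 0 < T by apply: lt_le_trans ltr01 _.
have C0 : 0 <= C by apply: le_trans C1.
have vT : v <= T ^+ 3.
  by rewrite /v !natrM !exprS expr0 mulr1 mulrA !ler_pM ?mulr_ge0.
have main : v * u ^+ 6 <= C ^+ 3 * (v * u) `^ (3 + 3 * e1).
  apply: (@le_trans _ _ (v * u ^+ k)); first by rewrite ler_wpM2l ?(ltW v0) // ler_weXn2l.
  have -> : v * u ^+ k = (a * x ^ k)%:R * (b * y ^ k)%:R * (c * z ^ k)%:R.
    by rewrite /u /v -natrX -!natrM; congr (_%:R); rewrite !expnMn; ring.
  have -> : (v * u) `^ (3 + 3 * e1) = ((v * u) `^ (1 + e1)) ^+ 3.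
    rewrite -powR_mulrn ?powR_ge0 // -powRrM; congr (_ `^ _); ring.
  have -> : v * u = (a * b * c * (x * y * z))%:R by rewrite [RHS]natrM.
  by rewrite -exprMn !exprS expr0 mulr1 mulrA; apply: ler_pM => //; apply: ler_pM.
have nzu : forall p : bool, p ==> (u != 0) by move=> p; rewrite (gt_eqF u0) implybT.
have nzv : forall p : bool, p ==> (v != 0) by move=> p; rewrite (gt_eqF v0) implybT.
have step : u `^ (3 - 3 * e1) <= C ^+ 3 * v `^ (2 + 3 * e1).
  have pos' : 0 < v * u `^ (3 + 3 * e1) by rewrite mulr_gt0 ?powR_gt0.
  rewrite -(ler_pM2l pos').
  have -> : v * u `^ (3 + 3 * e1) * u `^ (3 - 3 * e1) = v * u ^+ 6.
    rewrite -mulrA -powRD // -powR_mulrn ?(ltW u0) //; congr (_ * _ `^ _).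
    by ring.
  apply: le_trans main _; rewrite powRM ?(ltW v0) ?(ltW u0) //.
  have -> : v `^ (3 + 3 * e1) = v * v `^ (2 + 3 * e1).
    by rewrite -{2}(powRr1 (ltW v0)) -powRD //; congr (_ `^ _); ring.
  by rewrite le_eqVlt; apply/orP; left; apply/eqP; ring.
have -> : (x * y * z)%:R = (u `^ (3 - 3 * e1)) `^ q.
  by rewrite -powRrM divff ?gt_eqF // powRr1 // ltW.
apply: (@le_trans _ _ ((C ^+ 3 * v `^ (2 + 3 * e1)) `^ q)).
  by apply: ge0_ler_powR; rewrite ?nnegrE ?powR_ge0 ?(ltW q0) // mulr_ge0 ?powR_ge0 ?exprn_ge0.
rewrite powRM ?powR_ge0 ?exprn_ge0 // ler_wpM2l ?powR_ge0 // -powRrM.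
apply: (@le_trans _ _ ((T ^+ 3) `^ ((2 + 3 * e1) * q))).
  apply: ge0_ler_powR; rewrite ?nnegrE ?(ltW v0) ?exprn_ge0 ?(ltW T0) //.
  by rewrite mulr_ge0 ?(ltW q0) //; lra.
rewrite -powR_mulrn ?(ltW T0) // -powRrM; apply: ler_powR => //.
rewrite mulrA ler_pdivrMr //; move: e10 e1h e1e e0; clear => *; nra.
Qed.
End AbcConsequence.

(** * Harmonic sums *)

Section Harmonic.
Variable R : realType.

Definition harmonic_sum (n : nat) : R := \sum_(i < n) i.+1%:R^-1.

Lemma harmonic_sum_ge0 n : 0 <= harmonic_sum n.
Proof. by apply: sumr_ge0 => i _; rewrite invr_ge0. Qed.

Lemma harmonic_sum_ln n : harmonic_sum n.+1 <= 1 + ln n.+1%:R.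
Proof.
elim: n => [|n IH]; first by rewrite /harmonic_sum big_ord1 invr1 ln1 addr0.
rewrite /harmonic_sum big_ord_recr /= -/(harmonic_sum n.+1).
have n1 : 0 < n.+1%:R :> R by rewrite ltr0n.
have n2 : 0 < n.+2%:R :> R by rewrite ltr0n.
have : ln (1 + - n.+2%:R^-1) <= - n.+2%:R^-1 :> R.
  by apply: le_ln1Dx; rewrite ltrN2 invf_lt1 // ltr1n.
have -> : 1 + - n.+2%:R^-1 = n.+1%:R / n.+2%:R :> R.
  apply: (mulIf (lt0r_neq0 n2)); rewrite mulrBl mulVf ?divfK ?gt_eqF // mul1r.
  by rewrite -[n.+2%:R]natr1 addrK.
rewrite ln_div ?posrE // => h; move: IH h.
move: (ln _) (ln _) (harmonic_sum _) (_^-1) => a b c d; clear; lra.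
Qed.

Lemma harmonic_sum_powR (d : R) n : 0 < d -> (0 < n)%N ->
  harmonic_sum n <= (1 + d^-1) * n%:R `^ d.
Proof.
case: n => // n d0 _; apply: le_trans (harmonic_sum_ln n) _.
rewrite mulrDl mul1r lerD //; last by apply: ln_le_powR => //; rewrite ltr0n.
by rewrite -[leLHS](powRr0 n.+1%:R); apply: ler_powR; rewrite ?ler1n // ltW.
Qed.

End Harmonic.

(** * Global solutions split by the size of the largest variable *)

Section GlobalCount.
Variables (R : realType) (k N : nat) (s : bool * bool * bool).
Hypotheses (k6 : (6 <= k)%N) (N_gt0 : (0 < N)%N).
Local Notation box := ('I_N.+1 * 'I_N.+1 * 'I_N.+1)%type.

Definition small_sols : {pred box} := fun t =>
  `[< exists x y z : nat, [/\ (0 < z)%N, (x <= z)%N, (y <= z)%N &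
      [/\ gcdn (gcdn x y) z = 1%N, (z ^ k <= N ^ 2)%N &
        signed_sol k s t.1.1 t.1.2 t.2 x y z]] >].

Definition large_sols : {pred box} := fun t =>
  `[< [/\ (0 < t.1.1)%N, (0 < t.1.2)%N, (0 < t.2)%N &
    exists x y z : nat, [/\ (0 < z)%N, (x <= z)%N, (y <= z)%N &
      [/\ gcdn (gcdn x y) z = 1%N, (N ^ 2 < z ^ k)%N &
        signed_sol k s t.1.1 t.1.2 t.2 x y z]]] >].

(** As k >= 6, z^k <= N^2 gives z^3 <= N, so by [card_signed_sol] each (x, y, z) has at most 5 N^2 /
    z^3 triples. There are at most (2z)^2 pairs (x, y), which leaves 20 N^2 / z to be summed over
    z. *)
Lemma card_small_sols : #|small_sols|%:R <= 20 * N%:R ^+ 2 * harmonic_sum R N.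
Proof.
pose J : {pred 'I_N * ('I_N.+1 * 'I_N.+1)} :=
  [pred w : 'I_N * ('I_N.+1 * 'I_N.+1) |
  [&& (w.2.1 <= w.1.+1)%N, (w.2.2 <= w.1.+1)%N, (w.1.+1 ^ 3 <= N)%N &
     gcdn (gcdn w.2.1 w.2.2) w.1.+1 == 1%N]].
pose F (w : 'I_N * ('I_N.+1 * 'I_N.+1)) : {pred box} :=
  [pred t : box | signed_sol k s t.1.1 t.1.2 t.2 w.2.1 w.2.2 w.1.+1].
have cover t : t \in small_sols -> exists2 w, w \in J & t \in F w.
  move=> /asboolP[x [y [z [z0 xz yz [g zN sol]]]]].
  have z3 : (z ^ 3 <= N)%N.
    rewrite -(@leq_exp2r _ _ 2) // -expnM (leq_trans _ zN) //.
    by rewrite leq_pexp2l.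
  have zN' : (z <= N)%N by rewrite (leq_trans _ z3) // -{1}(expn1 z) leq_pexp2l.
  have zP : (z.-1 < N)%N by rewrite prednK.
  have xP : (x < N.+1)%N by rewrite ltnS (leq_trans xz).
  have yP : (y < N.+1)%N by rewrite ltnS (leq_trans yz).
  exists (Ordinal zP, (Ordinal xP, Ordinal yP)); rewrite !inE /= prednK //.
  by rewrite xz yz z3 g eqxx.
have := card_cover cover; rewrite -(ler_nat R) => /le_trans; apply.
rewrite natr_sum.
have NR : 0 < N%:R :> R by rewrite ltr0n.
pose G (i : 'I_N) : R := 5 * N%:R ^+ 2 / i.+1%:R ^+ 3.
have G0 i : 0 <= G i by rewrite divr_ge0 ?mulr_ge0 ?exprn_ge0.
have FJ w : w \in J -> #|F w|%:R <= G w.1.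
  move=> /and4P[xz yz z3 /eqP g].
  have := card_signed_sol k N s (isT : (0 < w.1.+1)%N) (etrans (gcdnA _ _ _) g).
  rewrite -(ler_nat R) !natrD !natrM !natrX; rewrite -/(F w).
  have z1 : 1 <= w.1.+1%:R :> R by rewrite ler1n.
  have : w.1.+1%:R ^+ 3 <= N%:R :> R by rewrite -natrX ler_nat.
  have : w.1.+1%:R ^+ 3 <= w.1.+1%:R ^+ k :> R by rewrite ler_weXn2l // (leq_trans _ k6).
  rewrite /G; set Z := w.1.+1%:R in z1 *.
  have N1 : 1 <= N%:R :> R by rewrite ler1n.
  have Z0 : 0 < Z ^+ 3 by rewrite exprn_gt0 // (lt_le_trans ltr01).
  rewrite ler_pdivlMr //; move: #|F w|%:R (Z ^+ 3) (Z ^+ k) N%:R N1 Z0 => f a b n.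
  clear => n1 a0 ab an h.
  have b0 : 0 < b by apply: lt_le_trans ab.
  have : f <= n ^+ 2 / b + 3 * n + 1.
    by rewrite -(ler_pM2l b0); apply: le_trans h _; rewrite mulrDr mulrDr mulr1
      [b * (_ / b)]mulrC divfK ?gt_eqF //; lra.
  have : n ^+ 2 / b <= n ^+ 2 / a by rewrite ler_wpM2l ?sqr_ge0 // lef_pV2.
  move=> h1 h2; have : f <= n ^+ 2 / a + 4 * n by lra.
  rewrite -(ler_pM2r a0) mulrDl divfK ?gt_eqF // => /le_trans; apply.
  by rewrite expr2; nra.
apply: (@le_trans _ _ (\sum_(w in J) G w.1)); first exact: ler_sum.
apply: (@le_trans _ _ (\sum_(i < N) \sum_(p : 'I_N.+1 * 'I_N.+1 |
    (p.1 < i.+2)%N && (p.2 < i.+2)%N) G i)).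
  rewrite pair_big_dep /= big_mkcond [leRHS]big_mkcond; apply: ler_sum => w _.
  case: ifPn => [/and4P[h1 h2 _ _]|_]; last by case: ifP.
  by rewrite !ltnS h1 h2.
rewrite /harmonic_sum mulr_sumr; apply: ler_sum => i _; rewrite sumr_const.
set m := #|_|; have : (m <= (2 * i.+1) ^ 2)%N.
  rewrite /m -mulnn (eq_card (B := [predX [pred p : 'I_N.+1 | (p < i.+2)%N] &
      [pred p : 'I_N.+1 | (p < i.+2)%N]])); last by move=> p; rewrite !inE.
  by rewrite cardX leq_mul // (leq_trans (card_ord_lt _ _)) //; lia.
rewrite -(ler_nat R) natrX natrM => h.
have i0 : 0 < i.+1%:R :> R by rewrite ltr0n.
rewrite -[G i *+ m]mulr_natr; apply: le_trans (ler_wpM2l (G0 i) h) _.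
by rewrite /G le_eqVlt; apply/orP; left; apply/eqP; field; rewrite gt_eqF.
Qed.

(** If x = 0 then z is prime to y, so z^k divides b, which is impossible for 0 < b <= N <= N^2 <
    z^k. The case y = 0 is symmetric. *)
Lemma large_sols_nonzero (t : box) x y z : (0 < t.1.1)%N -> (0 < t.1.2)%N ->
  (0 < z)%N -> gcdn (gcdn x y) z = 1%N -> (N ^ 2 < z ^ k)%N ->
  signed_sol k s t.1.1 t.1.2 t.2 x y z -> (0 < x)%N /\ (0 < y)%N.
Proof.
case: t => [[a b] c] /= a0 b0 z0 g big sol.
have k0 : (0 < k)%N by rewrite (leq_trans _ k6).
have leN (n : 'I_N.+1) : (0 < n)%N -> ~~ (z ^ k %| n)%N.
  move=> n0; apply/negP => /(dvdn_leq n0); rewrite leqNgt => /negP; apply.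
  apply: leq_ltn_trans big; rewrite -ltnS; apply: leq_trans (ltn_ord n) _.
  by rewrite ltnS -mulnn leq_pmulr.
split; rewrite lt0n; apply/negP => /eqP e0; subst.
  have [] := negP (leN b b0).
  have : (z ^ k %| b * y ^ k)%N.
    have sol' : signed_sol k (s.1.2, s.1.1, s.2) b a c y 0 z.
      by move: sol; rewrite /signed_sol /= [X in (X + _)%R]addrC.
    apply: signed_sol_dvd sol' _ _; last exact: dvdn_mull.
    by rewrite exp0n // muln0 dvdn0.
  rewrite Gauss_dvdl // coprimeXl // coprimeXr // coprime_sym.
  by rewrite gcd0n in g; rewrite /coprime g.
have [] := negP (leN a a0).
have : (z ^ k %| a * x ^ k)%N.
  apply: signed_sol_dvd sol _ _; last exact: dvdn_mull.
  by rewrite exp0n // muln0 dvdn0.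
rewrite Gauss_dvdl // coprimeXl // coprimeXr // coprime_sym.
by rewrite gcdn0 in g; rewrite /coprime g.
Qed.

Variables (e C : R).
Hypotheses (e_ge0 : 0 <= e) (C_ge1 : 1 <= C).
Hypothesis xyz_bound : forall (a b c x y z : nat) (T : R),
  [&& 0 < a, 0 < b, 0 < c, 0 < x, 0 < y & 0 < z]%N ->
  gcdn (gcdn a b) c = 1%N -> gcdn (gcdn x y) z = 1%N ->
  signed_sol k s a b c x y z -> a%:R <= T -> b%:R <= T -> c%:R <= T ->
  (x * y * z)%:R <= C * T `^ (2 + e).

(** A triple is determined by its gcd g and by (x, y, z), where xyz <= C (N / g)^(2+e). For fixed g,
    x, y the number of z is at most this bound divided by xy, and summing over g, x, y gives three
    harmonic sums. *)
Lemma card_large_sols :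
  #|large_sols|%:R <= C * N%:R `^ (2 + e) * harmonic_sum R N *
    harmonic_sum R (Num.truncn (C * N%:R `^ (2 + e))) ^+ 2.
Proof.
(* [U] bounds x, y and z uniformly in g, since N / g <= N. *)
set U := Num.truncn _.
have NR : 0 < N%:R :> R by rewrite ltr0n.
have C0 : 0 <= C by apply: le_trans C_ge1.
pose bnd (i : 'I_N) : R := C * (N%:R / i.+1%:R) `^ (2 + e).
pose J : {pred 'I_N * ('I_U * 'I_U * 'I_U)} :=
  [pred w : 'I_N * ('I_U * 'I_U * 'I_U) |
  (w.2.1.1.+1 * w.2.1.2.+1 * w.2.2.+1)%:R <= bnd w.1].
pose F (w : 'I_N * ('I_U * 'I_U * 'I_U)) : {pred box} := [pred t : box |
  [&& (0 < t.1.1)%N, (0 < t.1.2)%N, gcdn (gcdn t.1.1 t.1.2) t.2 == w.1.+1,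
   gcdn (gcdn w.2.1.1.+1 w.2.1.2.+1) w.2.2.+1 == 1%N, (N ^ 2 < w.2.2.+1 ^ k)%N &
   signed_sol k s t.1.1 t.1.2 t.2 w.2.1.1.+1 w.2.1.2.+1 w.2.2.+1]].
have F1 w : (#|F w| <= 1)%N.
  apply/card_le1_eqP => -[[a b] c] [[a' b'] c'].
  rewrite !inE /= => /and5P[a0 b0 /eqP gt /eqP gx /andP[big sol]].
  move=> /and5P[a'0 b'0 /eqP gt' _ /andP[_ sol']].
  have ordN (n : 'I_N.+1) : (n <= N)%N by rewrite -ltnS.
  have g0 : (0 < gcdn (gcdn a b) c)%N by rewrite gt.
  have [e1 e2 e3] := signed_sol_unique b0 b'0 (isT : (0 < w.2.2.+1)%N) (ordN a)
    (ordN b) (ordN a') (ordN b') gx big (etrans gt (esym gt')) g0 sol sol'.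
  by apply/esym; congr (_, _, _); apply: val_inj.
have cover t : t \in large_sols -> exists2 w, w \in J & t \in F w.
  move=> /asboolP[a0 b0 c0 [x [y [z [z0 xz yz [gx big sol]]]]]].
  have [x0 y0] := large_sols_nonzero a0 b0 z0 gx big sol.
  case: t a0 b0 c0 sol => [[a b] c] /= a0 b0 c0 sol.
  pose g := gcdn (gcdn a b) c.
  have g0 : (0 < g)%N by rewrite !gcdn_gt0 a0.
  have ga : (g %| a)%N by rewrite (dvdn_trans (dvdn_gcdl _ _)) ?dvdn_gcdl.
  have gb : (g %| b)%N by rewrite (dvdn_trans (dvdn_gcdl _ _)) ?dvdn_gcdr.
  have gc : (g %| c)%N by rewrite dvdn_gcdr.
  have gN : (g.-1 < N)%N.
    by rewrite prednK // (leq_trans (dvdn_leq a0 ga)) // -ltnS.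
  have ea : (g * (a %/ g) = a)%N by rewrite mulnC divnK.
  have eb : (g * (b %/ g) = b)%N by rewrite mulnC divnK.
  have ec : (g * (c %/ g) = c)%N by rewrite mulnC divnK.
  have gR : 0 < g%:R :> R by rewrite ltr0n.
  have leT (n : 'I_N.+1) : (g %| n)%N -> (n %/ g)%:R <= N%:R / g%:R :> R.
    move=> gn; rewrite ler_pdivlMr // -natrM divnK // ler_nat -ltnS.
    exact: ltn_ord.
  have dgt (n : nat) : (0 < n)%N -> (g %| n)%N -> (0 < n %/ g)%N.
    by move=> n0 gn; rewrite divn_gt0 // dvdn_leq.
  have hb : (x * y * z)%:R <= C * (N%:R / g%:R) `^ (2 + e).
    apply: (@xyz_bound (a %/ g) (b %/ g) (c %/ g)) => //; try exact: leT.
    - by rewrite (dgt _ a0 ga) (dgt _ b0 gb) (dgt _ c0 gc) x0 y0 z0.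
    - by apply/eqP; rewrite -(eqn_pmul2l g0) muln1 !muln_gcdr ea eb ec eqxx.
    - by rewrite -(signed_sol_scale _ _ _ _ _ _ _ _ g0) ea eb ec.
  have hU (n : nat) : (0 < n)%N -> (n <= x * y * z)%N -> (n.-1 < U)%N.
    move=> n0 nx; rewrite prednK // /U truncn_ge_nat ?mulr_ge0 ?powR_ge0 //.
    apply: (@le_trans _ _ (x * y * z)%:R); first by rewrite ler_nat.
    apply: le_trans hb _; rewrite ler_wpM2l //.
    apply: ge0_ler_powR; rewrite ?nnegrE ?addr_ge0 ?divr_ge0 //.
    by rewrite ler_pdivrMr // ler_peMr // ler1n.
  have xU : (x.-1 < U)%N by apply: hU; rewrite // -mulnA leq_pmulr ?muln_gt0 ?y0.
  have yU : (y.-1 < U)%N.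
    by apply: hU; rewrite // mulnAC leq_pmull ?muln_gt0 ?x0.
  have zU : (z.-1 < U)%N by apply: hU; rewrite // leq_pmull ?muln_gt0 ?x0.
  exists (Ordinal gN, (Ordinal xU, Ordinal yU, Ordinal zU)); rewrite !inE /= !prednK //.
    by rewrite /bnd /= prednK.
  by rewrite a0 b0 -/g eqxx gx eqxx big.
have := card_cover cover; rewrite -(ler_nat R) => /le_trans; apply.
apply: (@le_trans _ _ #|J|%:R).
  by rewrite ler_nat -sum1_card leq_sum.
have -> : #|J|%:R = \sum_(i < N) \sum_(x < U) \sum_(y < U)
    #|[pred z : 'I_U | (x.+1 * y.+1 * z.+1)%:R <= bnd i]|%:R :> R.
  under eq_bigr => i _ do under eq_bigr => x _ do under eq_bigr => y _ do
    rewrite -sum1_card natr_sum.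
  under eq_bigr => i _ do rewrite pair_big_dep pair_big_dep /=.
  rewrite pair_big_dep /= -sum1_card natr_sum.
  by apply: eq_bigl => -[i [[x y] z]]; rewrite !inE.
set A := C * N%:R `^ (2 + e).
have A0 : 0 <= A by rewrite mulr_ge0 ?powR_ge0.
apply: (@le_trans _ _ (\sum_(i < N) \sum_(x < U) \sum_(y < U)
    A * i.+1%:R^-1 * x.+1%:R^-1 * y.+1%:R^-1)); last first.
  under eq_bigr => i _ do under eq_bigr => x _ do rewrite -mulr_sumr.
  under eq_bigr => i _ do rewrite -mulr_suml -mulr_sumr.
  by rewrite -!mulr_suml -mulr_sumr -mulrA -expr2.
apply: ler_sum => i _; apply: ler_sum => x _; apply: ler_sum => y _.
have xy0 : 0 < (x.+1 * y.+1)%:R :> R by rewrite ltr0n.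
have b0 : 0 <= bnd i by rewrite mulr_ge0 ?powR_ge0.
pose r := bnd i / (x.+1 * y.+1)%:R.
have r0 : 0 <= r by rewrite divr_ge0 // ltW.
apply: (@le_trans _ _ r).
  apply: (@le_trans _ _ (Num.truncn r)%:R); last by rewrite truncn_le.
  rewrite ler_nat; apply: leq_trans (card_ord_lt (Num.truncn r) U).
  apply: subset_leq_card; apply/fintype.subsetP => z; rewrite !inE => h.
  by rewrite truncn_ge_nat // ler_pdivlMr // -natrM mulnC.
rewrite /r natrM invfM mulrA ler_wpM2r ?invr_ge0 // ler_wpM2r ?invr_ge0 //.
have i0 : 0 < i.+1%:R :> R by rewrite ltr0n.
rewrite /bnd /A powRM ?invr_ge0 // mulrA ler_wpM2l //.
(* The crude estimate (1 / g)^(2+e) <= 1 / g suffices. *)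
rewrite ge1r_powR //; last by rewrite -[leLHS]addr0 lerD // ler1n.
by rewrite invr_gt0 i0 invf_le1 // ler1n.
Qed.
End GlobalCount.

Lemma primitive_signed_sol k (a b c : int) : diag_solvable int k a b c ->
  exists s x y z, gcdn (gcdn x y) z = 1%N /\
    signed_sol k s `|a|%N `|b|%N `|c|%N x y z.
Proof.
case=> X [Y [Z [nz e]]]; rewrite !intz in e.
pose g := gcdn (gcdn `|X| `|Y|) `|Z|.
have g0 : (0 < g)%N.
  rewrite !gcdn_gt0 !absz_gt0; apply/negPn/negP.
  rewrite !negb_or !negbK => /andP[/andP[/eqP X0 /eqP Y0] /eqP Z0].
  exact: nz.
have gX : (g %| `|X|)%N by rewrite (dvdn_trans (dvdn_gcdl _ _)) ?dvdn_gcdl.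
have gY : (g %| `|Y|)%N by rewrite (dvdn_trans (dvdn_gcdl _ _)) ?dvdn_gcdr.
have gZ : (g %| `|Z|)%N by rewrite dvdn_gcdr.
(* The signs are those of whole terms, so they absorb the signs of both coefficients and
   variables. *)
exists (a * X ^+ k < 0, b * Y ^+ k < 0, c * Z ^+ k < 0).
exists (`|X| %/ g)%N, (`|Y| %/ g)%N, (`|Z| %/ g)%N; split.
  apply/eqP; rewrite -(eqn_pmul2r g0) !muln_gcdl !divnK // mul1n.
  exact: eqxx.
rewrite -(signed_sol_scale _ _ _ _ _ _ _ _ (d := g ^ k)) ?expn_gt0 ?g0 //.
have scale (m n : nat) : (g %| n)%N -> (g ^ k * m * (n %/ g) ^ k = m * n ^ k)%N.
  by move=> gn; rewrite mulnAC -expnMn mulnC [(g * _)%N]mulnC divnK.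
rewrite /signed_sol /= !scale // -!abszX -!abszM -!intEsign.
exact/eqP.
Qed.

(** The identity or a transposition bringing a chosen coordinate to the last place; it is used to
    make z the largest variable. *)
Definition swap3 (A : Type) (i : 'I_3) (t : A * A * A) : A * A * A :=
  if val i is 0 then t else if val i is 1 then (t.1.1, t.2, t.1.2)
  else (t.2, t.1.2, t.1.1).

Lemma swap3K (A : Type) i : involutive (@swap3 A i).
Proof. by case: i => [[|[|[|]]]] //= i [[a b] c]. Qed.

Lemma oriented_signed_sol k (t : int * int * int) :
  diag_solvable int k t.1.1 t.1.2 t.2 -> exists (i : 'I_3) s x y z,
    [/\ (0 < z)%N, (x <= z)%N, (y <= z)%N & gcdn (gcdn x y) z = 1%N /\
     let u := swap3 i t in signed_sol k s `|u.1.1|%N `|u.1.2|%N `|u.2|%N x y z].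
Proof.
case: t => [[a b] c] /= /primitive_signed_sol[[[s1 s2] s3] [x [y [z [g sol]]]]].
have pos (u v w : nat) : gcdn (gcdn u v) w = 1%N -> (u <= w)%N -> (v <= w)%N -> (0 < w)%N.
  move=> h uw vw; rewrite lt0n; apply/negP => /eqP w0; subst w.
  by move: h uw vw; rewrite !leqn0 => + /eqP u0 /eqP v0; rewrite u0 v0.
have [xz|zx] := leqP x z; last first.
  have [yx|xy] := leqP y x.
    have g' : gcdn (gcdn z y) x = 1%N by rewrite gcdnC gcdnA gcdnAC.
    exists (inord 2), (s3, s2, s1), z, y, x; split; rewrite ?(ltnW zx) //.
      exact: pos g' (ltnW zx) yx.
    split=> //; rewrite /swap3 /= inordK //=.
    by move: sol; rewrite /signed_sol /= addrC [X in _ + X]addrC addrA.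
  have g' : gcdn (gcdn x z) y = 1%N by rewrite -g gcdnAC.
  exists (inord 1), (s1, s3, s2), x, z, y; split; rewrite ?(ltnW xy) //.
  - exact: leq_ltn_trans xy.
  - by rewrite ltnW // (ltn_trans zx).
  split=> //; rewrite /swap3 /= inordK //=.
  by move: sol; rewrite /signed_sol /= addrAC.
have [yz|zy] := leqP y z.
  exists ord0, (s1, s2, s3), x, y, z; split=> //.
  exact: pos g xz yz.
have g' : gcdn (gcdn x z) y = 1%N by rewrite -g gcdnAC.
exists (inord 1), (s1, s3, s2), x, z, y; split; rewrite ?(ltnW zy) //.
- exact: leq_ltn_trans zy.
- by rewrite (leq_trans xz) // ltnW.
split=> //; rewrite /swap3 /= inordK //=.
by move: sol; rewrite /signed_sol /= addrAC.
Qed.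

Definition triple_sign (t : int * int * int) := (t.1.1 < 0, t.1.2 < 0, t.2 < 0).

(** A triple is recovered from a point of the box, the place of the largest variable (3 choices) and
    the signs of the coefficients (8 choices). Another 8 choices are the signs of the terms, and 192
    = 3 * 8 * 8. *)
Lemma M_glob_le_sols (R : realType) k (H K : R) (N := Num.truncn H) : 0 <= H ->
  (forall s, #|@small_sols k N s|%:R + #|@large_sols k N s|%:R <= K) ->
  (M_glob k H)%:R <= 192 * K.
Proof.
move=> H0 hK.
pose V : finType := ('I_3 * (bool * bool * bool) * (bool * bool * bool))%type.
pose box := ('I_N.+1 * 'I_N.+1 * 'I_N.+1)%type.
pose S (v : V) : {pred box} := [predU @small_sols k N v.2 & @large_sols k N v.2].
pose B : {pred V * box} := [pred w : V * box | w.2 \in S w.1].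
pose h (w : V * box) : int * int * int := let s := w.1.1.2 in
  swap3 w.1.1.1 ((-1) ^+ s.1.1 * (w.2.1.1 : nat)%:Z,
    (-1) ^+ s.1.2 * (w.2.1.2 : nat)%:Z, (-1) ^+ s.2 * (w.2.2 : nat)%:Z).
have le1 : (M_glob k H <= #|B|)%N.
  rewrite /M_glob cardE -(size_map h); apply: uniq_leq_size; first exact: fset_uniq.
  move=> t; rewrite in_fset_set; last first.
    by apply: sub_finite_set (finite_coef_box H) => u [].
  rewrite inE => -[[ta tb tc] /oriented_signed_sol[i [s [x [y [z [z0 xz yz [g sol]]]]]]]].
  have inN (m : int) : 0 < `|m%:~R : R| <= H -> (0 < `|m|)%N /\ (`|m| < N.+1)%N.
    rewrite -intr_norm -abszE -pmulrn ltr0n => /andP[m0 mH]; split=> //.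
    by rewrite ltnS /N truncn_ge_nat.
  pose u := swap3 i t.
  have [[u1 l1] [u2 l2] [u3 l3]] : [/\ (0 < `|u.1.1|)%N /\ (`|u.1.1| < N.+1)%N,
     (0 < `|u.1.2|)%N /\ (`|u.1.2| < N.+1)%N & (0 < `|u.2|)%N /\ (`|u.2| < N.+1)%N].
    by rewrite /u /swap3; case: (val i) => [|[|n]] /=; split; apply: inN.
  apply/mapP; exists ((i, triple_sign u, s), (Ordinal l1, Ordinal l2, Ordinal l3)).
    rewrite mem_enum inE /= /S inE /=.
    have [zN|zN] := leqP (z ^ k) (N ^ 2).
      by apply/orP; left; apply/asboolP; exists x, y, z.
    by apply/orP; right; apply/asboolP; split=> //; exists x, y, z.
  rewrite /h /= -!intEsign -[LHS](swap3K i) -/u; congr swap3.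
  by case: (u) => [[? ?] ?].
apply: (@le_trans _ _ #|B|%:R); first by rewrite ler_nat.
have -> : #|B| = (\sum_(v : V) #|S v|)%N.
  under eq_bigr => v _ do rewrite -sum1_card.
  by rewrite pair_big_dep /= -sum1_card; apply: eq_bigl => -[v t]; rewrite !inE.
rewrite natr_sum; apply: (@le_trans _ _ (\sum_(v : V) K)).
  apply: ler_sum => v _; apply: le_trans (hK v.2); rewrite -natrD ler_nat.
  by rewrite -cardUI leq_addr.
have -> : \sum_(v : V) K = 192 * K.
  by rewrite mulr_natl sumr_const !card_prod card_ord !card_bool.
exact: lexx.
Qed.

Lemma M_glob_growth (R : realType) k (d : R) : (6 <= k)%N -> abc_conjecture R ->
  0 < d -> exists2 C : R, 0 < C & forall H : R, 1 <= H ->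
    (M_glob k H)%:R <= C * H `^ (2 + d).
Proof.
(* The large solutions produce the exponent (2 + e) + e + 2 (3 e) = 2 + 8 e, where e <= 1 is used in
   (2 + e) e <= 3 e. *)
move=> k6 habc d0; pose e : R := Num.min 1 (d / 8).
have e0 : 0 < e by rewrite lt_min ltr01 divr_gt0.
have e1 : e <= 1 by rewrite ge_min lexx.
have e8 : 8 * e <= d.
  have : e <= d / 8 by rewrite ge_min lexx orbT.
  by rewrite ler_pdivlMr // mulrC.
have [C C1 hC] := abc_xyz_bound k6 habc e0.
have C0 : 0 < C by apply: lt_le_trans C1.
pose c1 : R := 1 + e^-1; have c10 : 0 < c1 by rewrite addr_gt0 ?invr_gt0.
pose K1 : R := 20 * c1 + C * c1 * (c1 * C `^ e) ^+ 2.
have K10 : 0 < K1.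
  by rewrite addr_gt0 ?mulr_gt0 ?exprn_gt0 ?mulr_gt0 ?powR_gt0.
exists (192 * K1); first by rewrite mulr_gt0.
move=> H H1; have H0 : 0 <= H by apply: le_trans H1.
rewrite -mulrA; apply: M_glob_le_sols => // s.
set N := Num.truncn H.
have N0 : (0 < N)%N by rewrite truncn_gt0.
have NR : 0 < N%:R :> R by rewrite ltr0n.
have N1 : 1 <= N%:R :> R by rewrite ler1n.
have NH : N%:R <= H by rewrite truncn_le.
pose W : R := N%:R `^ (2 + d).
have nzN (p : bool) : p ==> (N%:R != 0 :> R) by rewrite (gt_eqF NR) implybT.
have hN : harmonic_sum R N <= c1 * N%:R `^ e by apply: harmonic_sum_powR.
have ctx : #|@small_sols k N s|%:R + #|@large_sols k N s|%:R <= K1 * W.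
  rewrite mulrDl lerD //.
    apply: le_trans (card_small_sols R s k6 N0) _.
    apply: (@le_trans _ _ (20 * N%:R ^+ 2 * (c1 * N%:R `^ e))).
      by rewrite ler_wpM2l // mulr_ge0 // exprn_ge0.
    have -> : 20 * N%:R ^+ 2 * (c1 * N%:R `^ e) = 20 * c1 * (N%:R `^ (2 + e)).
      by rewrite powRD // powR_mulrn //; ring.
    rewrite ler_wpM2l ?mulr_ge0 ?(ltW c10) //; apply: ler_powR => //.
    by move: e0 e8 d0; clear; lra.
  apply: le_trans (card_large_sols k6 N0 (ltW e0) C1 (hC s)) _.
  set U := Num.truncn _.
  have U1 : 1 <= C * N%:R `^ (2 + e).
    rewrite -[leLHS]mulr1 ler_pM // -[leLHS](powRr0 N%:R); apply: ler_powR => //.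
    by move: e0; clear; lra.
  have U0 : (0 < U)%N by rewrite truncn_gt0.
  have UR : U%:R <= C * N%:R `^ (2 + e) by rewrite truncn_le (le_trans _ U1).
  have hU : harmonic_sum R U <= c1 * C `^ e * N%:R `^ (3 * e).
    apply: le_trans (harmonic_sum_powR e0 U0) _; rewrite -mulrA ler_wpM2l ?(ltW c10) //.
    apply: (@le_trans _ _ ((C * N%:R `^ (2 + e)) `^ e)).
      by apply: ge0_ler_powR; rewrite ?nnegrE ?(ltW e0) // (le_trans _ U1).
    rewrite powRM ?powR_ge0 ?(ltW C0) // ler_wpM2l ?powR_ge0 // -powRrM.
    by apply: ler_powR => //; rewrite ler_wpM2r ?(ltW e0) //; move: e1; clear; lra.
  apply: (@le_trans _ _ (C * N%:R `^ (2 + e) * (c1 * N%:R `^ e) *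
      (c1 * C `^ e * N%:R `^ (3 * e)) ^+ 2)).
    apply: ler_pM; rewrite ?exprn_ge0 ?mulr_ge0 ?harmonic_sum_ge0 ?powR_ge0 ?(ltW C0) //.
      by rewrite ler_wpM2l // mulr_ge0 ?powR_ge0 // ltW.
    by rewrite lerXn2r ?nnegrE ?harmonic_sum_ge0 ?mulr_ge0 ?powR_ge0 ?(ltW c10).
  have -> : C * N%:R `^ (2 + e) * (c1 * N%:R `^ e) * (c1 * C `^ e * N%:R `^ (3 * e)) ^+ 2 =
     C * c1 * (c1 * C `^ e) ^+ 2 * N%:R `^ (2 + 8 * e).
    have -> : 2 + 8 * e = (2 + e) + e + (3 * e + 3 * e) by ring.
    by rewrite !(powRD (nzN _)); ring.
  rewrite ler_wpM2l ?mulr_ge0 ?exprn_ge0 ?mulr_ge0 ?powR_ge0 ?(ltW C0) ?(ltW c10) //.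
  by apply: ler_powR => //; rewrite lerD2l.
apply: le_trans ctx _; rewrite ler_wpM2l ?(ltW K10) //.
by apply: ge0_ler_powR; rewrite ?nnegrE //; move: d0; clear; lra.
Qed.

(** * Comparison of the two counts *)

Theorem theorem2 (R : realType) (k : nat) (hk : (6 <= k)%N)
    (habc : abc_conjecture R) :
  (M_glob k H)%:R / (M_loc k H)%:R @[H --> (+oo : set_system R)] --> (0 : R).
Proof.
have k0 : (0 < k)%N by apply: leq_trans hk.
have kR : 0 < k%:R :> R by rewrite ltr0n.
(* For H of order X^k the global count has exponent k (2 + d) = 2k + 1/4 in X, the local one 2k +
   1/2. The ratio is thus O(X^(-1/4)), with constant [C3]. *)
pose d : R := (4 * k%:R)^-1; have d0 : 0 < d by rewrite invr_gt0 mulr_gt0.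
have [C C0 hC] := M_glob_growth hk habc d0.
have [c c0 [X0 hX0]] := M_loc_growth R k0.
pose C3 : R := C * 2 `^ (k%:R * (2 + d)) / c.
have C30 : 0 < C3 by rewrite divr_gt0 // mulr_gt0 // powR_gt0.
apply/cvgr0Pnorm_le => eps eps0.
have q0 : 0 < 4^-1 :> R by rewrite invr_gt0.
have [X1 hX1] := powR_eventually_ge (C3 / eps) q0.
pose X2 := (maxn X0 X1).+1.
near=> H.
have HX : (X2 ^ k)%:R <= H by near: H; apply: nbhs_pinfty_ge; rewrite num_real.
have H1 : 1 <= H by apply: le_trans HX; rewrite ler1n expn_gt0.
have H0 : 0 <= H by apply: le_trans H1.
(* X = floor(H^(1/k)); later H <= (X + 1)^k <= (2X)^k, which explains the power of 2 in [C3]. *)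
have [X [XX2 XH HXS]] : exists X : nat, [/\ (X2 <= X)%N, (X ^ k)%:R <= H &
    H <= (X.+1 ^ k)%:R].
  pose X := Num.truncn (H `^ k%:R^-1).
  have HK : H = (H `^ k%:R^-1) ^+ k.
    by rewrite -powR_mulrn ?powR_ge0 // -powRrM mulVf ?gt_eqF // powRr1.
  have /andP[Xle Xlt] := truncn_itv (powR_ge0 H k%:R^-1).
  exists X; split.
  - rewrite truncn_ge_nat ?powR_ge0 // -(@ler_pXn2r _ k) ?nnegrE ?powR_ge0 //.
    by rewrite -HK -natrX.
  - by rewrite HK natrX lerXn2r ?nnegrE ?powR_ge0.
  - by rewrite HK natrX lerXn2r ?nnegrE ?powR_ge0 // ltW.
have X_gt0 : (0 < X)%N by apply: leq_trans XX2.
have XR : 0 < X%:R :> R by rewrite ltr0n.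
have locX : c * X%:R `^ (2 * k%:R + 2^-1) <= (M_loc k H)%:R.
  by apply: hX0 XH; apply: leq_trans XX2; rewrite /X2 (leq_trans (leq_maxl _ X1)).
have epsX : C3 / eps <= X%:R `^ 4^-1.
  by apply: hX1; apply: leq_trans XX2; rewrite /X2 (leq_trans (leq_maxr X0 _)).
have loc0 : 0 < (M_loc k H)%:R :> R.
  by apply: lt_le_trans locX; rewrite mulr_gt0 // powR_gt0.
rewrite ger0_norm ?divr_ge0 // ler_pdivrMr //.
apply: le_trans (hC H H1) _.
apply: (@le_trans _ _ (eps * (c * X%:R `^ (2 * k%:R + 2^-1)))); last first.
  by rewrite ler_wpM2l // ltW.
apply: (@le_trans _ _ (C * ((2 * X%:R) `^ k%:R) `^ (2 + d))).
  rewrite ler_wpM2l ?(ltW C0) //; apply: ge0_ler_powR; rewrite ?nnegrE ?powR_ge0 //.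
    by move: d0; clear; lra.
  rewrite powR_mulrn ?mulr_ge0 //; apply: le_trans HXS _.
  rewrite natrX lerXn2r ?nnegrE ?mulr_ge0 //.
  by rewrite -natrM ler_nat mul2n -addnn -addn1 leq_add2l.
rewrite -powRrM powRM // mulrA.
have -> : X%:R `^ (2 * k%:R + 2^-1) = X%:R `^ (k%:R * (2 + d)) * X%:R `^ 4^-1.
  rewrite -powRD; last by rewrite (gt_eqF XR) implybT.
  by congr (_ `^ _); rewrite /d; field; rewrite gt_eqF.
have -> : eps * (c * (X%:R `^ (k%:R * (2 + d)) * X%:R `^ 4^-1)) =
  (eps * c * X%:R `^ 4^-1) * X%:R `^ (k%:R * (2 + d)) by ring.
rewrite ler_wpM2r ?powR_ge0 //.
have -> : C * 2 `^ (k%:R * (2 + d)) = C3 * c by rewrite /C3 divfK // gt_eqF.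
rewrite [leRHS]mulrAC ler_wpM2r ?(ltW c0) //.
by move: epsX; rewrite ler_pdivrMr // mulrC.
Unshelve. all: by end_near.
Qed.
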